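(* Let $k$ be a field of characteristic $0$ and let $k\{z_1,z_2,\ldots,z_m\}$ be the free Poisson algebra over $k$ in the variables $z_1,z_2,\ldots,z_m$. Suppose that $f\in k\{z_1,z_2,\ldots,z_m\}$ and $f\notin k\{z_1,z_2,\ldots,z_{m-1}\}$. Then the (Poisson) subalgebra of the quotient algebra $k\{z_1,z_2,\ldots,z_m\}/(f)$ generated by $z_1+(f),z_2+(f),\ldots,z_{m-1}+(f)$ is the free Poisson algebra with free generators $z_1+(f),z_2+(f),\ldots,z_{m-1}+(f)$.
   Context: A Poisson algebra over a field $k$ is a $k$-vector space $B$ with two bilinear operations $x\cdot y$ and $\{x,y\}$ such that $B$ is a commutative associative (unital) algebra under $x\cdot y$, a Lie algebra under $\{x,y\}$, and the Leibniz identity $\{x,y\cdot z\}=\{x,y\}\cdot z+y\cdot\{x,z\}$ holds. For a Lie algebra $\mathfrak g$ with linear basis $e_1,e_2,\ldots$, the symmetric Poisson algebra $PS(\mathfrak g)$ is the polynomial algebra $k[e_1,e_2,\ldots]$ with the Poisson bracket determined by $\{e_i,e_j\}=[e_i,e_j]$. The free Poisson algebra $k\{z_1,\ldots,z_m\}$ is $PS(\mathfrak g)$, where $\mathfrak g$ is the free Lie algebra on $z_1,\ldots,z_m$. The algebra $k\{z_1,\ldots,z_{m-1}\}$ is regarded as the Poisson subalgebra of $k\{z_1,\ldots,z_m\}$ generated by $z_1,\ldots,z_{m-1}$. $(f)$ denotes the ideal of the Poisson algebra $k\{z_1,\ldots,z_m\}$ generated by $f$, i.e. the smallest subspace containing $f$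 that is closed under both multiplication by, and Poisson bracket with, arbitrary elements of the algebra; the quotient by $(f)$ is again a Poisson algebra. *)

(* Defs.v *)
From HB Require Import structures.
From mathcomp Require Import all_boot all_algebra.
From mathcomp Require Import generic_quotient finmap.
From mathcomp Require Import mathcomp_extra boolp classical_sets.
From mathcomp Require Import ring.
From mathcomp.multinomials Require Import monalg.

Set Implicit Arguments.
Unset Strict Implicit.
Unset Printing Implicit Defensive.

Import GRing.Theory.
Local Open Scope ring_scope.
Local Open Scope classical_set_scope.
Local Open Scope quotient_scope.

(** * Lie algebras and Poisson algebras *)

HB.mixin Record Lmodule_isLieAlgebra (k : fieldType) L of GRing.Lmodule k L := {
  lie : L -> L -> L;
  lie_linearl : forall a x y z, lie (a *: x + y) z = a *: lie x z + lie y z;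
  lie_linearr : forall a x y z, lie z (a *: x + y) = a *: lie z x + lie z y;
  liexx : forall x, lie x x = 0;
  lie_jacobi : forall x y z,
    lie x (lie y z) + lie y (lie z x) + lie z (lie x y) = 0
}.

#[short(type="lieAlgType")]
HB.structure Definition LieAlgebra (k : fieldType) :=
  {L of GRing.Lmodule k L & Lmodule_isLieAlgebra k L}.

HB.mixin Record isPoissonAlgebra (k : fieldType) B
    of LieAlgebra k B & GRing.ComAlgebra k B := {
  lie_leibniz : forall x y z : B, lie x (y * z) = lie x y * z + y * lie x z
}.

#[short(type="poissonAlgType")]
HB.structure Definition PoissonAlgebra (k : fieldType) :=
  {B of LieAlgebra k B & GRing.ComAlgebra k B & isPoissonAlgebra k B}.

Section LieTheory.
Variables (k : fieldType) (L : lieAlgType k).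
Implicit Types x y z : L.

Lemma lieDl x y z : lie (x + y) z = lie x z + lie y z.
Proof. by have := lie_linearl 1 x y z; rewrite !scale1r. Qed.

Lemma lieDr x y z : lie z (x + y) = lie z x + lie z y.
Proof. by have := lie_linearr 1 x y z; rewrite !scale1r. Qed.

Lemma lie0l z : lie 0 z = 0.
Proof. by apply: (addrI (lie 0 z)); rewrite -lieDl !addr0. Qed.

Lemma lie0r z : lie z 0 = 0.
Proof. by apply: (addrI (lie z 0)); rewrite -lieDr !addr0. Qed.

Lemma lieZl (a : k) x z : lie (a *: x) z = a *: lie x z.
Proof. by have := lie_linearl a x 0 z; rewrite lie0l !addr0. Qed.

Lemma lieZr (a : k) x z : lie z (a *: x) = a *: lie z x.
Proof. by have := lie_linearr a x 0 z; rewrite lie0r !addr0. Qed.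

Lemma lieNl x z : lie (- x) z = - lie x z.
Proof. by rewrite -scaleN1r lieZl scaleN1r. Qed.

Lemma lieNr x z : lie z (- x) = - lie z x.
Proof. by rewrite -scaleN1r lieZr scaleN1r. Qed.

Lemma lieC x y : lie x y = - lie y x.
Proof.
apply/eqP; rewrite -addr_eq0; apply/eqP.
by have := liexx (x + y); rewrite lieDl !lieDr !liexx add0r addr0.
Qed.

End LieTheory.

Section PoissonTheory.
Variables (k : fieldType) (B : poissonAlgType k).
Implicit Types x y : B.

Definition poisson_hom (B' : poissonAlgType k) (phi : B -> B') : Prop :=
  [/\ linear phi, monoid_morphism phi & {morph phi : x y / lie x y}].

Record poisson_subalgebra (S : set B) : Prop := PoissonSubalgebra {
  psub1 : S 1;
  psubD : forall x y, S x -> S y -> S (x + y);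
  psubZ : forall (a : k) x, S x -> S (a *: x);
  psubM : forall x y, S x -> S y -> S (x * y);
  psub_lie : forall x y, S x -> S y -> S (lie x y)
}.

Definition gen_subalgebra (X : set B) : set B :=
  [set x | forall S, poisson_subalgebra S -> X `<=` S -> S x].

Record poisson_ideal (I : set B) : Prop := PoissonIdeal {
  pideal0 : I 0;
  pidealD : forall x y, I x -> I y -> I (x + y);
  pidealZ : forall (a : k) x, I x -> I (a *: x);
  pidealM : forall b x, I x -> I (b * x);
  pideal_lie : forall b x, I x -> I (lie b x)
}.

Definition gen_ideal (f : B) : set B :=
  [set x | forall I, poisson_ideal I -> I f -> I x].

Lemma gen_idealP f : poisson_ideal (gen_ideal f).
Proof.
split.
- by move=> I hI _; exact: pideal0.
- by move=> x y hx hy I hI If; apply: (pidealD hI); [exact: hx|exact: hy].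
- by move=> a x hx I hI If; apply: (pidealZ hI); exact: hx.
- by move=> b x hx I hI If; apply: (pidealM hI); exact: hx.
- by move=> b x hx I hI If; apply: (pideal_lie hI); exact: hx.
Qed.

End PoissonTheory.

(** * Quotient of a Poisson algebra by a proper Poisson ideal *)

(* [I1] is needed because a [comAlgType] is nonzero by definition. *)

Section Quotient.
Variables (k : fieldType) (B : poissonAlgType k) (I : set B).
Hypotheses (hI : poisson_ideal I) (I1 : ~ I 1).

Definition pideal_rel (x y : B) : bool := `[< I (x - y) >].

Lemma pideal_opp x : I x -> I (- x).
Proof. by rewrite -scaleN1r; exact: pidealZ. Qed.

Lemma pideal_rel_refl : reflexive pideal_rel.
Proof. by move=> x; apply/asboolP; rewrite subrr; exact: pideal0. Qed.

Lemma pideal_rel_sym : symmetric pideal_rel.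
Proof.
by move=> x y; apply/asboolP/asboolP => /pideal_opp; rewrite opprB.
Qed.

Lemma pideal_rel_trans : transitive pideal_rel.
Proof.
move=> y x z /asboolP hxy /asboolP hyz; apply/asboolP.
by rewrite -(subrK y x) -addrA; apply: (pidealD hI).
Qed.

Canonical pideal_equiv :=
  EquivRel pideal_rel pideal_rel_refl pideal_rel_sym pideal_rel_trans.

Definition poisson_quotient of ~ I 1 : Type := {eq_quot pideal_equiv}.
Local Notation Q := (poisson_quotient I1).

HB.instance Definition _ := Choice.on Q.

Definition pquot_class (x : B) : Q := \pi_{eq_quot pideal_equiv} x.
Local Notation "[ x ]" := (pquot_class x).

Lemma pquot_eqP x y : [x] = [y] <-> I (x - y).
Proof.
split; first by move=> /eqmodP /asboolP.
by move=> h; apply/eqmodP/asboolP.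
Qed.

Lemma pquot_ind (P : Q -> Prop) : (forall x, P [x]) -> forall q, P q.
Proof. by move=> h q; rewrite -[q]reprK; exact: h. Qed.

Definition pquot_op1 (op : B -> B) (q : Q) : Q := [op (repr q)].
Definition pquot_op2 (op : B -> B -> B) (q r : Q) : Q :=
  [op (repr q) (repr r)].

Lemma pquot_repr x : I (repr [x] - x).
Proof. by apply/pquot_eqP; exact: reprK. Qed.

Lemma pquot_op1E op : (forall x y, I (x - y) -> I (op x - op y)) ->
  forall x, pquot_op1 op [x] = [op x].
Proof. by move=> h x; apply/pquot_eqP/h/pquot_repr. Qed.

Lemma pquot_op2E op :
  (forall x y z, I (x - y) -> I (op x z - op y z)) ->
  (forall x y z, I (x - y) -> I (op z x - op z y)) ->
  forall x y, pquot_op2 op [x] [y] = [op x y].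
Proof.
move=> hl hr x y; apply/pquot_eqP.
rewrite -(subrK (op x (repr [y])) (op _ _)) -addrA.
by apply: (pidealD hI); [apply: hl|apply: hr]; exact: pquot_repr.
Qed.

Definition pquot_opp := pquot_op1 -%R.
Definition pquot_add := pquot_op2 +%R.
Definition pquot_mul := pquot_op2 *%R.
Definition pquot_scale (a : k) := pquot_op1 ( *:%R a).
Definition pquot_lie := pquot_op2 lie.

Lemma pquot_oppE x : pquot_opp [x] = [- x].
Proof.
by apply: pquot_op1E => {}x y h; rewrite -opprD; exact: pideal_opp.
Qed.

Lemma pquot_addE x y : pquot_add [x] [y] = [x + y].
Proof.
apply: pquot_op2E => {}x {}y z h.
  by rewrite opprD addrACA subrr addr0.
by rewrite opprD addrACA subrr add0r.
Qed.

Lemma pquot_mulE x y : pquot_mul [x] [y] = [x * y].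
Proof.
apply: pquot_op2E => {}x {}y z h.
  by rewrite -mulrBl mulrC; exact: pidealM.
by rewrite -mulrBr; exact: pidealM.
Qed.

Lemma pquot_scaleE a x : pquot_scale a [x] = [a *: x].
Proof.
by apply: pquot_op1E => {}x y h; rewrite -scalerBr; exact: pidealZ.
Qed.

Lemma pquot_lieE x y : pquot_lie [x] [y] = [lie x y].
Proof.
apply: pquot_op2E => {}x {}y z h; last first.
  by rewrite -lieNr -lieDr; exact: pideal_lie.
by rewrite -lieNl -lieDl lieC; apply/pideal_opp; exact: pideal_lie.
Qed.

Definition pquotE :=
  (pquot_oppE, pquot_addE, pquot_mulE, pquot_scaleE, pquot_lieE).

Let elimQ := pquot_ind.

Fact pquot_addA : associative pquot_add.
Proof.
by elim/elimQ=> x; elim/elimQ=> y; elim/elimQ=> z; rewrite !pquotE addrA.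
Qed.

Fact pquot_addC : commutative pquot_add.
Proof. by elim/elimQ=> x; elim/elimQ=> y; rewrite !pquotE addrC. Qed.

Fact pquot_add0 : left_id [0] pquot_add.
Proof. by elim/elimQ=> x; rewrite !pquotE add0r. Qed.

Fact pquot_addN : left_inverse [0] pquot_opp pquot_add.
Proof. by elim/elimQ=> x; rewrite !pquotE addNr. Qed.

HB.instance Definition _ :=
  GRing.isZmodule.Build Q pquot_addA pquot_addC pquot_add0 pquot_addN.

Fact pquot_mulA : associative pquot_mul.
Proof.
by elim/elimQ=> x; elim/elimQ=> y; elim/elimQ=> z; rewrite !pquotE mulrA.
Qed.

Fact pquot_mulC : commutative pquot_mul.
Proof. by elim/elimQ=> x; elim/elimQ=> y; rewrite !pquotE mulrC. Qed.

Fact pquot_mul1 : left_id [1] pquot_mul.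
Proof. by elim/elimQ=> x; rewrite !pquotE mul1r. Qed.

Fact pquot_mulDl : left_distributive pquot_mul +%R.
Proof.
elim/elimQ=> x; elim/elimQ=> y; elim/elimQ=> z.
by rewrite /GRing.add /= !pquotE mulrDl.
Qed.

Fact pquot_1neq0 : [1] != 0.
Proof. by apply/eqP => /pquot_eqP; rewrite subr0. Qed.

HB.instance Definition _ := GRing.Zmodule_isComNzRing.Build Q
  pquot_mulA pquot_mulC pquot_mul1 pquot_mulDl pquot_1neq0.

Fact pquot_scaleA a b q :
  pquot_scale a (pquot_scale b q) = pquot_scale (a * b) q.
Proof. by elim/elimQ: q => x; rewrite !pquotE scalerA. Qed.

Fact pquot_scale1 : left_id 1 pquot_scale.
Proof. by elim/elimQ=> x; rewrite !pquotE scale1r. Qed.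

Fact pquot_scaleDr : right_distributive pquot_scale +%R.
Proof.
move=> a; elim/elimQ=> x; elim/elimQ=> y.
by rewrite /GRing.add /= !pquotE scalerDr.
Qed.

Fact pquot_scaleDl q : {morph pquot_scale^~ q : a b / a + b}.
Proof.
move=> a b; elim/elimQ: q => x.
by rewrite [in RHS]/GRing.add /= !pquotE scalerDl.
Qed.

HB.instance Definition _ := GRing.Zmodule_isLmodule.Build k Q
  pquot_scaleA pquot_scale1 pquot_scaleDr pquot_scaleDl.

Lemma pquot_classD x y : [x + y] = [x] + [y].
Proof. by rewrite /GRing.add /= !pquotE. Qed.

Lemma pquot_classM x y : [x * y] = [x] * [y].
Proof. by rewrite [in RHS]/GRing.mul /= !pquotE. Qed.

Lemma pquot_classZ a x : [a *: x] = a *: [x].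
Proof. by rewrite [in RHS]/GRing.scale /= !pquotE. Qed.

Fact pquot_scalerAl (a : k) (q r : Q) : a *: (q * r) = (a *: q) * r.
Proof.
elim/elimQ: q => x; elim/elimQ: r => y.
by rewrite -pquot_classM -!pquot_classZ -pquot_classM scalerAl.
Qed.

HB.instance Definition _ := GRing.Lmodule_isLalgebra.Build k Q pquot_scalerAl.
HB.instance Definition _ := GRing.Lalgebra_isComAlgebra.Build k Q.

Fact pquot_lie_linearl a (q r s : Q) :
  pquot_lie (a *: q + r) s = a *: pquot_lie q s + pquot_lie r s.
Proof.
elim/elimQ: q => x; elim/elimQ: r => y; elim/elimQ: s => z.
by rewrite -pquot_classZ -pquot_classD !pquotE lie_linearl pquot_classD pquot_classZ.
Qed.

Fact pquot_lie_linearr a (q r s : Q) :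
  pquot_lie s (a *: q + r) = a *: pquot_lie s q + pquot_lie s r.
Proof.
elim/elimQ: q => x; elim/elimQ: r => y; elim/elimQ: s => z.
by rewrite -pquot_classZ -pquot_classD !pquotE lie_linearr pquot_classD pquot_classZ.
Qed.

Fact pquot_liexx (q : Q) : pquot_lie q q = 0.
Proof. by elim/elimQ: q => x; rewrite pquotE liexx. Qed.

Fact pquot_lie_jacobi (q r s : Q) :
  pquot_lie q (pquot_lie r s) + pquot_lie r (pquot_lie s q)
  + pquot_lie s (pquot_lie q r) = 0.
Proof.
elim/elimQ: q => x; elim/elimQ: r => y; elim/elimQ: s => z.
by rewrite !pquotE -!pquot_classD lie_jacobi.
Qed.

HB.instance Definition _ := Lmodule_isLieAlgebra.Build k Q
  pquot_lie_linearl pquot_lie_linearr pquot_liexx pquot_lie_jacobi.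

Fact pquot_leibniz (q r s : Q) : lie q (r * s) = lie q r * s + r * lie q s.
Proof.
elim/elimQ: q => x; elim/elimQ: r => y; elim/elimQ: s => z.
rewrite -pquot_classM /lie /= !pquotE -!pquot_classM -pquot_classD.
by rewrite lie_leibniz.
Qed.

HB.instance Definition _ := isPoissonAlgebra.Build k Q pquot_leibniz.

End Quotient.

Arguments poisson_quotient {k B I} hI I1.
Arguments pquot_class {k B I} hI I1 x.

(** * Free Lie algebra *)

Section FreeLie.
Variables (k : fieldType) (X : Type).

Inductive lie_term : Type :=
  | LieVar of X
  | LieZero
  | LieOpp of lie_term
  | LieAdd of lie_term & lie_term
  | LieScale of k & lie_term
  | LieBr of lie_term & lie_term.

Inductive lie_eq : lie_term -> lie_term -> Prop :=
  | lie_eq_refl s : lie_eq s s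
  | lie_eq_sym s t : lie_eq s t -> lie_eq t s
  | lie_eq_trans s t u : lie_eq s t -> lie_eq t u -> lie_eq s u
  | lie_eq_opp s s' : lie_eq s s' -> lie_eq (LieOpp s) (LieOpp s')
  | lie_eq_add s s' t t' : lie_eq s s' -> lie_eq t t' ->
      lie_eq (LieAdd s t) (LieAdd s' t')
  | lie_eq_scale a s s' : lie_eq s s' -> lie_eq (LieScale a s) (LieScale a s')
  | lie_eq_br s s' t t' : lie_eq s s' -> lie_eq t t' ->
      lie_eq (LieBr s t) (LieBr s' t')
  | lie_eq_addA s t u :
      lie_eq (LieAdd s (LieAdd t u)) (LieAdd (LieAdd s t) u)
  | lie_eq_addC s t : lie_eq (LieAdd s t) (LieAdd t s)
  | lie_eq_add0 s : lie_eq (LieAdd LieZero s) s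
  | lie_eq_addN s : lie_eq (LieAdd (LieOpp s) s) LieZero
  | lie_eq_scaleA a b s :
      lie_eq (LieScale a (LieScale b s)) (LieScale (a * b) s)
  | lie_eq_scale1 s : lie_eq (LieScale 1 s) s
  | lie_eq_scaleDr a s t :
      lie_eq (LieScale a (LieAdd s t)) (LieAdd (LieScale a s) (LieScale a t))
  | lie_eq_scaleDl a b s :
      lie_eq (LieScale (a + b) s) (LieAdd (LieScale a s) (LieScale b s))
  | lie_eq_linl a s t u :
      lie_eq (LieBr (LieAdd (LieScale a s) t) u)
             (LieAdd (LieScale a (LieBr s u)) (LieBr t u))
  | lie_eq_linr a s t u :
      lie_eq (LieBr u (LieAdd (LieScale a s) t))
             (LieAdd (LieScale a (LieBr u s)) (LieBr u t))
  | lie_eq_alt s : lie_eq (LieBr s s) LieZero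
  | lie_eq_jacobi s t u :
      lie_eq (LieAdd (LieAdd (LieBr s (LieBr t u)) (LieBr t (LieBr u s)))
                     (LieBr u (LieBr s t)))
             LieZero.

HB.instance Definition _ := gen_eqMixin lie_term.
HB.instance Definition _ := gen_choiceMixin lie_term.

Definition lie_eqb (s t : lie_term) : bool := `[< lie_eq s t >].

Lemma lie_eqb_refl : reflexive lie_eqb.
Proof. by move=> s; apply/asboolP; exact: lie_eq_refl. Qed.

Lemma lie_eqb_sym : symmetric lie_eqb.
Proof. by move=> s t; apply/asboolP/asboolP; exact: lie_eq_sym. Qed.

Lemma lie_eqb_trans : transitive lie_eqb.
Proof.
by move=> t s u /asboolP h /asboolP h'; apply/asboolP/(lie_eq_trans h h').
Qed.

Canonical lie_equiv := EquivRel lie_eqb lie_eqb_refl lie_eqb_sym lie_eqb_trans.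

(* The free Lie algebra on X: formal Lie expressions in elements of X, modulo
   the congruence generated by the axioms of a Lie algebra over k. *)
Definition free_lie : Type := {eq_quot lie_equiv}.

HB.instance Definition _ := Choice.on free_lie.

Definition flie_class (s : lie_term) : free_lie := \pi_{eq_quot lie_equiv} s.
Local Notation "[ s ]" := (flie_class s).

Lemma flie_eqP s t : [s] = [t] <-> lie_eq s t.
Proof.
split; first by move=> /eqmodP /asboolP.
by move=> h; apply/eqmodP/asboolP.
Qed.

Lemma flie_class_ind (P : free_lie -> Prop) : (forall s, P [s]) -> forall x, P x.
Proof. by move=> h x; rewrite -[x]reprK; exact: h. Qed.

Lemma flie_repr s : lie_eq (repr [s]) s.
Proof. by apply/flie_eqP; exact: reprK. Qed.

Definition flie_gen (x : X) : free_lie := [LieVar x].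
Definition flie_opp (x : free_lie) := [LieOpp (repr x)].
Definition flie_add (x y : free_lie) := [LieAdd (repr x) (repr y)].
Definition flie_scale a (x : free_lie) := [LieScale a (repr x)].
Definition flie_br (x y : free_lie) := [LieBr (repr x) (repr y)].

Lemma flie_oppE s : flie_opp [s] = [LieOpp s].
Proof. by apply/flie_eqP/lie_eq_opp/flie_repr. Qed.

Lemma flie_addE s t : flie_add [s] [t] = [LieAdd s t].
Proof. by apply/flie_eqP/lie_eq_add; apply: flie_repr. Qed.

Lemma flie_scaleE a s : flie_scale a [s] = [LieScale a s].
Proof. by apply/flie_eqP/lie_eq_scale/flie_repr. Qed.

Lemma flie_brE s t : flie_br [s] [t] = [LieBr s t].
Proof. by apply/flie_eqP/lie_eq_br; apply: flie_repr. Qed.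

Definition flieE := (flie_oppE, flie_addE, flie_scaleE, flie_brE).

Let elimF := flie_class_ind.

Fact flie_addA : associative flie_add.
Proof.
elim/elimF=> s; elim/elimF=> t; elim/elimF=> u; rewrite !flieE.
exact/flie_eqP/lie_eq_addA.
Qed.

Fact flie_addC : commutative flie_add.
Proof.
elim/elimF=> s; elim/elimF=> t; rewrite !flieE; exact/flie_eqP/lie_eq_addC.
Qed.

Fact flie_add0 : left_id [LieZero] flie_add.
Proof. elim/elimF=> s; rewrite !flieE; exact/flie_eqP/lie_eq_add0. Qed.

Fact flie_addN : left_inverse [LieZero] flie_opp flie_add.
Proof. elim/elimF=> s; rewrite !flieE; exact/flie_eqP/lie_eq_addN. Qed.

HB.instance Definition _ :=
  GRing.isZmodule.Build free_lie flie_addA flie_addC flie_add0 flie_addN.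

Fact flie_scaleA a b x : flie_scale a (flie_scale b x) = flie_scale (a * b) x.
Proof. elim/elimF: x => s; rewrite !flieE; exact/flie_eqP/lie_eq_scaleA. Qed.

Fact flie_scale1 : left_id 1 flie_scale.
Proof. elim/elimF=> s; rewrite !flieE; exact/flie_eqP/lie_eq_scale1. Qed.

Fact flie_scaleDr : right_distributive flie_scale +%R.
Proof.
move=> a; elim/elimF=> s; elim/elimF=> t.
by rewrite /GRing.add /= !flieE; exact/flie_eqP/lie_eq_scaleDr.
Qed.

Fact flie_scaleDl x : {morph flie_scale^~ x : a b / a + b}.
Proof.
move=> a b; elim/elimF: x => s.
by rewrite [in RHS]/GRing.add /= !flieE; exact/flie_eqP/lie_eq_scaleDl.
Qed.

HB.instance Definition _ := GRing.Zmodule_isLmodule.Build k free_lie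
  flie_scaleA flie_scale1 flie_scaleDr flie_scaleDl.

Fact flie_linearl a (x y z : free_lie) :
  flie_br (a *: x + y) z = a *: flie_br x z + flie_br y z.
Proof.
elim/elimF: x => s; elim/elimF: y => t; elim/elimF: z => u.
rewrite /GRing.add /GRing.scale /= !flieE; exact/flie_eqP/lie_eq_linl.
Qed.

Fact flie_linearr a (x y z : free_lie) :
  flie_br z (a *: x + y) = a *: flie_br z x + flie_br z y.
Proof.
elim/elimF: x => s; elim/elimF: y => t; elim/elimF: z => u.
rewrite /GRing.add /GRing.scale /= !flieE; exact/flie_eqP/lie_eq_linr.
Qed.

Fact flie_brxx (x : free_lie) : flie_br x x = 0.
Proof. elim/elimF: x => s; rewrite flieE; exact/flie_eqP/lie_eq_alt. Qed.

Fact flie_jacobi (x y z : free_lie) :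
  flie_br x (flie_br y z) + flie_br y (flie_br z x) + flie_br z (flie_br x y)
  = 0.
Proof.
elim/elimF: x => s; elim/elimF: y => t; elim/elimF: z => u.
rewrite /GRing.add /= !flieE; exact/flie_eqP/lie_eq_jacobi.
Qed.

HB.instance Definition _ := Lmodule_isLieAlgebra.Build k free_lie
  flie_linearl flie_linearr flie_brxx flie_jacobi.

Section UniversalProperty.
Variables (L : lieAlgType k) (h : X -> L).

Fixpoint lie_eval (s : lie_term) : L :=
  match s with
  | LieVar x => h x
  | LieZero => 0
  | LieOpp s => - lie_eval s
  | LieAdd s t => lie_eval s + lie_eval t
  | LieScale a s => a *: lie_eval s
  | LieBr s t => lie (lie_eval s) (lie_eval t)
  end.

Lemma lie_eval_eq s t : lie_eq s t -> lie_eval s = lie_eval t.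
Proof.
elim=> //=; try by move=> *; congruence.
- by move=> *; rewrite addrA.
- by move=> *; rewrite addrC.
- by move=> *; rewrite add0r.
- by move=> *; rewrite addNr.
- by move=> *; rewrite scalerA.
- by move=> *; rewrite scale1r.
- by move=> *; rewrite scalerDr.
- by move=> *; rewrite scalerDl.
- by move=> *; rewrite lie_linearl.
- by move=> *; rewrite lie_linearr.
- by move=> *; rewrite liexx.
- by move=> *; rewrite lie_jacobi.
Qed.

Definition flie_lift (x : free_lie) : L := lie_eval (repr x).

Lemma flie_liftE s : flie_lift [s] = lie_eval s.
Proof. exact/lie_eval_eq/flie_repr. Qed.

Lemma free_lieP : exists! phi : free_lie -> L,
  [/\ linear phi, {morph phi : x y / lie x y} & forall x, phi (flie_gen x) = h x].
Proof.
exists flie_lift; split.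
  split=> [a|  |x]; last exact: flie_liftE.
    elim/elimF=> s; elim/elimF=> t.
    by rewrite /GRing.add /GRing.scale /= !flieE !flie_liftE.
  elim/elimF=> s; elim/elimF=> t.
  by rewrite [in LHS]/lie /= !flieE !flie_liftE.
move=> psi [psi_lin psi_lie psi_gen]; apply: funext.
have psi0 : psi 0 = 0.
  apply: (addrI (psi 0)); have := psi_lin 1 0 0.
  by rewrite !scale1r !addr0 => <-.
have psiZ a x : psi (a *: x) = a *: psi x.
  by rewrite -[a *: x]addr0 psi_lin psi0 addr0.
have psiD x y : psi (x + y) = psi x + psi y.
  by have := psi_lin 1 x y; rewrite !scale1r.
elim/elimF=> s; rewrite flie_liftE.
elim: s => [x||s IHs|s IHs t IHt|a s IHs|s IHs t IHt] /=.
- by rewrite -psi_gen.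
- exact: esym psi0.
- by rewrite IHs -flie_oppE -[flie_opp _]/(- [s]) -!scaleN1r psiZ.
- by rewrite IHs IHt -flie_addE psiD.
- by rewrite IHs -flie_scaleE psiZ.
- by rewrite IHs IHt -flie_brE psi_lie.
Qed.

End UniversalProperty.

End FreeLie.

Arguments flie_gen k {X} x.

(** * Bases of possibly infinite dimensional vector spaces *)

Section LinComb.
Variables (k : fieldType) (V : lmodType k) (I : choiceType) (e : I -> V).

Definition lin_comb (c : {malg k[I]}) : V := \sum_(i <- msupp c) c@_i *: e i.

Lemma lin_combEw (d : {fset I}) c : (msupp c `<=` d)%fset ->
  lin_comb c = \sum_(i <- d) c@_i *: e i.
Proof.
move=> le; rewrite [LHS](big_fset_incl _ le) => //= i _ /mcoeff_outdom ->.
by rewrite scale0r.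
Qed.

Fact lin_comb_is_linear : linear lin_comb.
Proof.
move=> a c c'; pose d := (msupp c `|` msupp c' `|` msupp (a *: c + c'))%fset.
rewrite !(@lin_combEw d) ?fsubsetUr //; first last.
- by rewrite /d -fsetUA fsubsetUl.
- by rewrite /d fsetUAC fsubsetUr.
rewrite scaler_sumr -big_split /=; apply: eq_bigr => i _.
by rewrite mcoeffD mcoeffZ scalerDl scalerA.
Qed.

HB.instance Definition _ :=
  GRing.isLinear.Build k {malg k[I]} V _ lin_comb lin_comb_is_linear.

Lemma lin_combU a i : lin_comb << a *g i >> = a *: e i.
Proof. by rewrite (lin_combEw msuppU_le) big_seq_fset1 mcoeffUU. Qed.

End LinComb.

Record basis (k : fieldType) (V : lmodType k) := Basis {
  basis_idx : choiceType;
  basis_vec :> basis_idx -> V;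
  basisP : forall v, exists! c : {malg k[basis_idx]}, lin_comb basis_vec c = v
}.

Definition basis_coord (k : fieldType) (V : lmodType k) (e : basis V) (v : V) :
    {malg k[basis_idx e]} :=
  projT1 (cid (basisP e v)).

Section BasisTheory.
Variables (k : fieldType) (V : lmodType k) (e : basis V).

Lemma basis_coordK v : lin_comb e (basis_coord e v) = v.
Proof. by rewrite /basis_coord; case: cid => c [/= ]. Qed.

Lemma lin_combK c : basis_coord e (lin_comb e c) = c.
Proof. by rewrite /basis_coord; case: cid => c' [/= _]; apply. Qed.

Fact basis_coord_is_linear : linear (basis_coord e).
Proof.
move=> a v w; rewrite -{1}[v]basis_coordK -{1}[w]basis_coordK.
by rewrite -linearP lin_combK.
Qed.

HB.instance Definition _ :=
  GRing.isLinear.Build k V {malg k[basis_idx e]} _ (basis_coord e) basis_coord_is_linear.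

Lemma basis_ext (W : lmodType k) (F G : V -> W) : linear F -> linear G ->
  (forall i, F (e i) = G (e i)) -> F =1 G.
Proof.
have lin0 (H : V -> W) : linear H -> H 0 = 0.
  move=> Hlin; apply: (addrI (H 0)).
  by have := Hlin 1 0 0; rewrite !scale1r !addr0 => <-.
move=> Flin Glin FG v; rewrite -(basis_coordK v) /lin_comb.
elim/big_rec: _ => [|i w _ IHw]; first by rewrite !lin0.
by rewrite Flin Glin IHw FG.
Qed.

End BasisTheory.

Section HamelBasis.
Variables (k : fieldType) (V : lmodType k).

Let lc (c : {malg k[V]}) : V := lin_comb id c.
Let supp_in (A : set V) (c : {malg k[V]}) := forall v, v \in msupp c -> A v.
Let indep (A : set V) := forall c, supp_in A c -> lc c = 0 -> c = 0.

Lemma max_indep_spans : exists2 A : set V, indep A &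
  forall v, exists2 c, supp_in A c & lc c = v.
Proof.
have [|A [iA maxA]] := @Zorn_bigcup V indep.
  move=> F Fi Ft c hc c0.
  have : c != 0 -> exists2 X, F X & forall v, v \in msupp c -> X v.
    move=> cn0.
    have aux (s : seq V) : (forall v, v \in s -> (\bigcup_(X in F) X) v) ->
        s = [::] \/ exists2 X, F X & forall v, v \in s -> X v.
      elim: s => [|v s IHs] h; [by left|right].
      have [X FX Xv] := h v (mem_head _ _).
      have {IHs} [|->|[Y FY Ys]] := IHs.
      - by move=> w ws; apply: h; rewrite inE ws orbT.
      - by exists X => // w; rewrite inE => /eqP ->.
      have [XY|YX] := Ft _ _ FX FY.
      - by exists Y => // w; rewrite inE => /orP[/eqP ->|/Ys //]; exact: XY.
      - by exists X => // w; rewrite inE => /orP[/eqP -> //|/Ys]; exact: YX.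
    have [s0|//] := aux (enum_fset (msupp c)) hc.
    case/eqP: cn0; apply/malgP => v; rewrite mcoeff0 mcoeff_outdom //.
    by rewrite -[v \in _]/(v \in enum_fset (msupp c)) s0.
  have [->//|cn0 /(_ isT)[X FX Xc]] := eqVneq c 0.
  exact: (Fi X FX c Xc c0).
exists A => // v; apply: contrapT => hv.
have Av : ~ A v.
  move=> Av; apply: hv; exists << v >>; last by rewrite /lc lin_combU scale1r.
  by move=> w; rewrite msuppU oner_eq0 in_fset1 => /eqP ->.
apply: (maxA (A `|` [set v])).
  by split; [move=> w; left|move=> /(_ v) h; apply/Av/h; right].
move=> c hc c0; have [cv0|cvn0] := eqVneq c@_v 0.
  apply: iA => // w wc; have [//|/= wv] := hc w wc.
  by move: wc; rewrite -mcoeff_neq0 wv cv0 eqxx.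
case: hv; exists (- (c@_v)^-1 *: (c - << c@_v *g v >>)).
  move=> w; rewrite -mcoeff_neq0 mcoeffZ mcoeffB mcoeffU.
  have [<-|vw] := eqVneq v w; first by rewrite subrr mulr0 eqxx.
  rewrite subr0 mulf_eq0 negb_or => /andP[_]; rewrite mcoeff_neq0 => /hc[//|/=].
  by move=> wv; rewrite wv eqxx in vw.
rewrite /lc linearZ linearB /= -/(lc c) c0 lin_combU sub0r scaleNr scalerN.
by rewrite opprK scalerA mulVf // scale1r.
Qed.

Definition hamel_set : set V := projT1 (cid2 max_indep_spans).
Definition hamel_idx : choiceType := {v : V | `[< hamel_set v >]}.

Lemma hamel_basisP v :
  exists! c : {malg k[hamel_idx]}, lin_comb (fun i : hamel_idx => val i) c = v.
Proof.
have [iA sA] : indep hamel_set /\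
    forall v, exists2 c, supp_in hamel_set c & lc c = v.
  by rewrite /hamel_set; case: cid2.
pose e (i : hamel_idx) : V := val i.
pose up := lin_comb (fun i : hamel_idx => << e i >> : {malg k[V]}).
have upK c : lc (up c) = lin_comb e c.
  rewrite /lc /up [in LHS](_ : lin_comb _ c = \sum_(i <- msupp c) c@_i *: << e i >>) //.
  rewrite raddf_sum; apply: eq_bigr => i _.
  by rewrite /= linearZ /= lin_combU scale1r.
have upE c i : (up c)@_(e i) = c@_i.
  rewrite /up (@lin_combEw _ _ _ _ (i |` msupp c)%fset) ?fsubsetUr // raddf_sum /=.
  rewrite (big_fsetD1 i) ?fset1U1 //= mcoeffZ mcoeffUU mulr1 big1_fset ?addr0 //.
  move=> j; rewrite in_fsetD1 => /andP[ji _] _; rewrite mcoeffZ mcoeffU.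
  by rewrite (inj_eq val_inj) (negPf ji) mulr0.
have up_supp c : supp_in hamel_set (up c).
  move=> w; rewrite -mcoeff_neq0 /up /lin_comb raddf_sum /=.
  move=> /eqP h; apply: contrapT => hw; apply: h; rewrite big1_fset // => i _ _.
  rewrite mcoeffZ mcoeffU; case: eqP => [iw|]; last by rewrite mulr0.
  by case: hw; rewrite -iw; apply/asboolP; exact: valP i.
have [c hc cv] := sA v.
pose f (w : V) : {malg k[hamel_idx]} := if insub w is Some i then << i >> else 0.
have fcv : lin_comb e (lin_comb f c) = v.
  rewrite -cv.
  rewrite (_ : lin_comb f c = \sum_(w <- msupp c) c@_w *: f w) // raddf_sum.
  apply: eq_big_seq => w wc; rewrite /= linearZ /= /f insubT; first exact/asboolP/hc.
  by move=> wA; rewrite lin_combU scale1r.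
exists (lin_comb f c); split => // c' c'v; set c1 := lin_comb f c in fcv *.
have : up (c1 - c') = 0.
  apply: iA; first exact: up_supp.
  by rewrite upK linearB /= fcv c'v subrr.
move=> up0; apply/eqP; rewrite -subr_eq0; apply/eqP/malgP => i.
by rewrite -upE up0 !mcoeff0.
Qed.

Definition hamel_basis : basis V := Basis hamel_basisP.

End HamelBasis.

(** * Symmetric Poisson algebra of a Lie algebra *)

Section LeibnizLinear.
Variables (k : fieldType) (A : comAlgType k).
Implicit Types (p q : A).

Lemma leibZl (D : {linear A -> A}) c p q : D (p * q) = D p * q + p * D q ->
  D ((c *: p) * q) = D (c *: p) * q + (c *: p) * D q.
Proof. by move=> h; rewrite -!scalerAl !linearZ /= h -scalerAl scalerDr. Qed.

Lemma leibZr (D : {linear A -> A}) c p q : D (p * q) = D p * q + p * D q ->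
  D (p * (c *: q)) = D p * (c *: q) + p * D (c *: q).
Proof. by move=> h; rewrite -!scalerAr !linearZ /= h -scalerAr scalerDr. Qed.

Lemma leibDl (D : {linear A -> A}) p p' q : D (p * q) = D p * q + p * D q ->
  D (p' * q) = D p' * q + p' * D q ->
  D ((p + p') * q) = D (p + p') * q + (p + p') * D q.
Proof. by move=> h h'; rewrite !mulrDl !linearD /= h h' mulrDl addrACA. Qed.

Lemma leibDr (D : {linear A -> A}) p q q' : D (p * q) = D p * q + p * D q ->
  D (p * q') = D p * q' + p * D q' ->
  D (p * (q + q')) = D p * (q + q') + p * D (q + q').
Proof. by move=> h h'; rewrite !mulrDr !linearD /= h h' mulrDr addrACA. Qed.

End LeibnizLinear.

(* Lie brackets on a commutative algebra A generated by a family X over which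
   derivations can be prescribed freely. *)
Section GeneratedBracket.
Variables (k : fieldType) (A : comAlgType k) (I : Type) (X : I -> A).
Variable der : (I -> A) -> A -> A.
Hypothesis A_ind : forall Q : A -> Prop, (forall c, Q c%:A) ->
  (forall i, Q (X i)) -> (forall p q, Q p -> Q q -> Q (p + q)) ->
  (forall p q, Q p -> Q q -> Q (p * q)) -> forall p, Q p.
Hypothesis der_linear : forall a, linear (der a).
Hypothesis derM : forall a p q, der a (p * q) = der a p * q + p * der a q.
Hypothesis derX : forall a i, der a (X i) = a i.
Implicit Types (p q r : A) (a b : I -> A).

Let derD a p q : der a (p + q) = der a p + der a q.
Proof. by have := der_linear a 1 p q; rewrite !scale1r. Qed.

Let der0 a : der a 0 = 0.
Proof. by apply: (addrI (der a 0)); rewrite -derD !addr0. Qed.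

Let derZ a c p : der a (c *: p) = c *: der a p.
Proof. by have := der_linear a c p 0; rewrite der0 !addr0. Qed.

Let derN a p : der a (- p) = - der a p.
Proof. by rewrite -scaleN1r derZ scaleN1r. Qed.

Let derC a c : der a c%:A = 0.
Proof.
rewrite derZ; suff -> : der a 1 = 0 by rewrite scaler0.
have := derM a 1 1; rewrite !mul1r mulr1 => h.
by apply: (addrI (der a 1)); rewrite -h addr0.
Qed.

Lemma gder_linear a b x p :
  der (fun i => x * a i + b i) p = x * der a p + der b p.
Proof.
elim/A_ind: p => [c|i|p q IHp IHq|p q IHp IHq].
- by rewrite !derC mulr0 addr0.
- by rewrite !derX.
- by rewrite !derD IHp IHq mulrDr addrACA.
- rewrite !derM IHp IHq mulrDl !mulrDr addrACA; congr (_ + _ + _).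
    by rewrite mulrA.
  by rewrite mulrCA.
Qed.

Let der00 p : der (fun=> 0) p = 0.
Proof.
have := gder_linear (fun=> 0) (fun=> 0) (- 1) p.
rewrite (_ : (fun i : I => _) = fun=> 0); first by rewrite mulN1r addNr.
by apply: funext => i; rewrite mulr0 addr0.
Qed.

Lemma gder_unique (D : A -> A) :
  linear D -> (forall p q, D (p * q) = D p * q + p * D q) ->
  D =1 der (fun i => D (X i)).
Proof.
move=> Dlin DM.
have DD p q : D (p + q) = D p + D q.
  by have := Dlin 1 p q; rewrite !scale1r.
have D0 : D 0 = 0 by apply: (addrI (D 0)); rewrite -DD !addr0.
have D1 : D 1 = 0.
  have := DM 1 1; rewrite !mul1r mulr1 => h.
  by apply: (addrI (D 1)); rewrite -h addr0.
elim/A_ind=> [c|i|p q IHp IHq|p q IHp IHq].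
- by rewrite derC -[c%:A]addr0 Dlin D0 D1 scaler0 addr0.
- by rewrite derX.
- by rewrite derD DD IHp IHq.
- by rewrite derM DM IHp IHq.
Qed.

Variable c : I -> I -> A.

Definition gbr p q : A := der (fun i => der (c i) q) p.

Lemma gbrXX i j : gbr (X i) (X j) = c i j.
Proof. by rewrite /gbr !derX. Qed.

Lemma gbr_linearl x p q r : gbr (x *: p + q) r = x *: gbr p r + gbr q r.
Proof. exact: der_linear. Qed.

Lemma gbr_linearr x p q r : gbr r (x *: p + q) = x *: gbr r p + gbr r q.
Proof.
rewrite /gbr -[x *: der _ r]mulr_algl -gder_linear; congr (der _ r).
by apply: funext => i; rewrite der_linear mulr_algl.
Qed.

Let gbrDl p q r : gbr (p + q) r = gbr p r + gbr q r.
Proof. by have := gbr_linearl 1 p q r; rewrite !scale1r. Qed.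

Let gbrDr p q r : gbr r (p + q) = gbr r p + gbr r q.
Proof. by have := gbr_linearr 1 p q r; rewrite !scale1r. Qed.

Lemma gbrMl p q r : gbr (p * q) r = gbr p r * q + p * gbr q r.
Proof. exact: derM. Qed.

Lemma gbrMr p q r : gbr r (p * q) = gbr r p * q + p * gbr r q.
Proof.
rewrite addrC [gbr r p * q]mulrC /gbr.
have -> : q * der (fun i => der (c i) p) r =
    der (fun i => q * der (c i) p + 0) r.
  by rewrite gder_linear der00 addr0.
rewrite -gder_linear; congr (der _ r); apply: funext => i.
by rewrite derM addr0 addrC [q * _]mulrC.
Qed.

Let gbrCl x q : gbr x%:A q = 0.
Proof. exact: derC. Qed.

Let gbrCr x q : gbr q x%:A = 0.
Proof.
elim/A_ind: q => [y|i|p q IHp IHq|p q IHp IHq].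
- exact: gbrCl.
- by rewrite /gbr derX derC.
- by rewrite gbrDl IHp IHq addr0.
- by rewrite gbrMl IHp IHq mul0r mulr0 addr0.
Qed.

Hypothesis c_alt : forall i, c i i = 0.
Hypothesis c_anti : forall i j, c i j = - c j i.

Let gbrC p q : gbr p q = - gbr q p.
Proof.
elim/A_ind: p => [x|i|p p' IHp IHp'|p p' IHp IHp'].
- by rewrite gbrCl gbrCr oppr0.
- elim/A_ind: q => [x|j|q q' IHq IHq'|q q' IHq IHq'].
  + by rewrite gbrCl gbrCr oppr0.
  + by rewrite !gbrXX c_anti.
  + by rewrite gbrDl gbrDr IHq IHq' opprD.
  + by rewrite gbrMl gbrMr IHq IHq' mulNr mulrN opprD.
- by rewrite gbrDl gbrDr IHp IHp' opprD.
- by rewrite gbrMl gbrMr IHp IHp' mulNr mulrN opprD.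
Qed.

Lemma gbrxx p : gbr p p = 0.
Proof.
elim/A_ind: p => [x|i|p q IHp IHq|p q IHp IHq].
- exact: gbrCl.
- by rewrite gbrXX.
- by rewrite gbrDl !gbrDr IHp IHq add0r addr0 gbrC addNr.
- rewrite gbrMl !gbrMr IHp IHq mul0r mulr0 add0r addr0 [gbr q p]gbrC.
  by rewrite mulNr mulrN mulrA -[_ * gbr p q * q]mulrA [gbr p q * q]mulrC subrr.
Qed.

Let gbrNr p q : gbr p (- q) = - gbr p q.
Proof.
have gbr0 : gbr p 0 = 0 by apply: (addrI (gbr p 0)); rewrite -gbrDr !addr0.
by apply/eqP; rewrite -addr_eq0 -gbrDr addNr gbr0.
Qed.

Hypothesis c_jacobi : forall i j l,
  gbr (X i) (c j l) + gbr (X j) (c l i) + gbr (X l) (c i j) = 0.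

Let jac p q r := gbr p (gbr q r) + gbr q (gbr r p) + gbr r (gbr p q).

Let jac_rot p q r : jac p q r = jac q r p.
Proof. by rewrite /jac -addrA addrC. Qed.

Let jacD p p' q r : jac (p + p') q r = jac p q r + jac p' q r.
Proof.
by rewrite /jac !(gbrDl, gbrDr); ring.
Qed.

Let jacM p p' q r : jac (p * p') q r = jac p q r * p' + p * jac p' q r.
Proof.
rewrite /jac !(gbrMl, gbrMr, gbrDr).
move: (gbr p (gbr q r)) (gbr p' (gbr q r)) (gbr q (gbr r p))
  (gbr q (gbr r p')) (gbr r (gbr p q)) (gbr r (gbr p' q)).
by move=> *; rewrite [gbr p q]gbrC [gbr p' q]gbrC; ring.
Qed.

Let jacC x q r : jac x%:A q r = 0.
Proof.
have gbr0 p : gbr p 0 = 0 by apply: (addrI (gbr p 0)); rewrite -gbrDr !addr0.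
by rewrite /jac !gbrCl gbrCr !gbr0 !addr0.
Qed.

Let jac_ind q r : (forall i, jac (X i) q r = 0) -> forall p, jac p q r = 0.
Proof.
move=> h; elim/A_ind=> [x|i|p p' IHp IHp'|p p' IHp IHp'] //.
- by rewrite jacD IHp IHp' addr0.
- by rewrite jacM IHp IHp' mul0r mulr0 addr0.
Qed.

Lemma gbr_jacobi p q r :
  gbr p (gbr q r) + gbr q (gbr r p) + gbr r (gbr p q) = 0.
Proof.
rewrite -/(jac p q r); apply: jac_ind => i {p}; rewrite jac_rot.
apply: jac_ind => j {q}; rewrite jac_rot; apply: jac_ind => l {r}.
by rewrite jac_rot /jac !gbrXX; exact: c_jacobi.
Qed.

End GeneratedBracket.

Section PolyDer.
Variables (k : fieldType) (I : choiceType).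
Local Notation P := {malg k[{cmonom I}]}.
Implicit Types (m : {cmonom I}) (p q : P) (a : I -> P).

Definition mon_der a m : P :=
  \sum_(i <- finsupp m) (a i * << divcm m (ucm i) >>) *+ m i.

(* The derivation \sum_i a_i * d/dX_i of the polynomial ring k[X_i | i in I]. *)
Definition poly_der a : P -> P := lin_comb (mon_der a).

HB.instance Definition _ a := GRing.Linear.on (poly_der a).

Lemma mon_derEw a m (d : {fset I}) : (finsupp m `<=` d)%fset ->
  mon_der a m = \sum_(i <- d) (a i * << divcm m (ucm i) >>) *+ m i.
Proof.
move=> le; rewrite [LHS](big_fset_incl _ le) => //= i _.
by rewrite -cmE_eq0 => /eqP ->; rewrite mulr0n.
Qed.

Lemma poly_derU a m : poly_der a << m >> = mon_der a m.
Proof. by rewrite /poly_der lin_combU scale1r. Qed.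

Lemma mulUU m m' : << m >> * << m' >> = << mmul m m' >> :> P.
Proof. by rewrite malgM_def fgmulUU mulr1. Qed.

Lemma divcmMl m m' i : (0 < m i)%N ->
  divcm (mmul m m') (ucm i) = mmul (divcm m (ucm i)) m'.
Proof.
move=> mi; apply/eqP/cmP => j; rewrite divcmE !cmM divcmE ucmE.
have [<-|_] := eqVneq i j; last by rewrite !subn0.
by rewrite addnBAC.
Qed.

Lemma mon_derM a m m' :
  mon_der a (mmul m m') = mon_der a m * << m' >> + << m >> * mon_der a m'.
Proof.
have aux1 (x y z : P) n : (x * (y * z)) *+ n = (x * y) *+ n * z.
  by rewrite mulrA mulrnAl.
have aux2 (x y z : P) n : (x * (y * z)) *+ n = z * ((x * y) *+ n).
  by rewrite mulrA mulrC mulrnAr.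
pose d := (finsupp m `|` finsupp m')%fset.
rewrite !(@mon_derEw a _ d) ?mdomD ?fsubsetUl ?fsubsetUr //.
rewrite mulr_suml mulr_sumr -big_split /=; apply: eq_bigr => i _.
rewrite (cmM i m m') [LHS]mulrnDr; congr +%R.
  have := @divcmMl m m' i; case: (m i) => [|n] E; first by rewrite mul0r.
  by rewrite E // -(mulUU (divcm m (ucm i)) m'); exact: aux1.
rewrite (mulmC m m'); have := @divcmMl m' m i.
case: (m' i) => [|n] E; first by rewrite mulr0.
by rewrite E // -(mulUU (divcm m' (ucm i)) m); exact: aux2.
Qed.

Lemma mon_ind (Q : P -> Prop) :
  (forall m, Q << m >>) -> (forall c p, Q p -> Q (c *: p)) ->
  (forall p q, Q p -> Q q -> Q (p + q)) -> forall p, Q p.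
Proof.
move=> QU QZ QD p; rewrite (monalgE p); elim/big_ind: _ => // [|m _].
  by rewrite -(scale0r << mone >>); exact: QZ.
have -> : << p@_m *g m >> = p@_m *: << m >> :> P.
  by rewrite -mul_malgC malgM_def fgmulUU mulr1 mul1m.
exact: QZ.
Qed.

Lemma mpoly_ind (Q : P -> Prop) :
  (forall c, Q c%:A) -> (forall i, Q << ucm i >>) ->
  (forall p q, Q p -> Q q -> Q (p + q)) ->
  (forall p q, Q p -> Q q -> Q (p * q)) -> forall p, Q p.
Proof.
move=> QC QX QD QM p.
have Qm m : Q << m >>.
  elim: {m}(mdeg m) {-2}m (erefl (mdeg m)) => [|n IHn] m hm.
    by rewrite (mdeg_eq0I hm) -[<< _ >>]scale1r; exact: QC.
  have [i mi] : exists i, (0 < m i)%N.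
    apply: contrapT => h; suff m1 : m = mone by rewrite m1 mdeg1 in hm.
    apply/eqP/cmP => i; rewrite cm1; apply/eqP; rewrite -leqn0 leqNgt.
    by apply/negP => mi; apply: h; exists i.
  have mE : m = mmul (ucm i) (divcm m (ucm i)).
    apply/eqP/cmP => j; rewrite cmM divcmE ucmE.
    by have [<-|_] := eqVneq i j; rewrite ?subn0 // subnKC.
  rewrite mE -mulUU; apply: QM => //; apply: IHn.
  by move: hm; rewrite {1}mE mdegM mdegU => -[].
elim/mon_ind: p => // c p Qp; rewrite -mulr_algl; exact: QM.
Qed.

Lemma poly_derM a p q :
  poly_der a (p * q) = poly_der a p * q + p * poly_der a q.
Proof.
elim/mon_ind: p => [m|c p IHp|p p' IHp IHp'].
- have derUU m' : poly_der a (<< m >> * << m' >>) =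
      poly_der a << m >> * << m' >> + << m >> * poly_der a << m' >>.
    apply: (etrans (congr1 (poly_der a) (mulUU m m'))).
    apply: (etrans (poly_derU a _)); apply: (etrans (mon_derM a m m')).
    exact: (congr2 +%R (congr1 ( *%R^~ << m' >>) (esym (poly_derU a m)))
                       (congr1 ( *%R << m >>) (esym (poly_derU a m')))).
  move: << m >> derUU => {m} x derUU.
  elim/mon_ind: q => [m'|c q IHq|q q' IHq IHq'].
  - exact: derUU.
  - exact: (@leibZr k P (poly_der a) c x q IHq).
  - exact: (@leibDr k P (poly_der a) x q q' IHq IHq').
- exact: (@leibZl k P (poly_der a) c p q IHp).
- exact: (@leibDl k P (poly_der a) p p' q IHp IHp').
Qed.

Lemma poly_derX a i : poly_der a << ucm i >> = a i.
Proof.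
rewrite poly_derU /mon_der mdomU big_seq_fset1 ucmE eqxx mulr1n.
have -> : divcm (ucm i) (ucm i) = mone :> {cmonom I}.
  by apply/eqP/cmP => j; rewrite divcmE subnn cm1.
by rewrite -[<< _ >>]/(1 : P) mulr1.
Qed.

End PolyDer.

Section SymPoisson.
Variables (k : fieldType) (g : lieAlgType k) (e : basis g).
Local Notation I := (basis_idx e).

Definition sym_poisson : Type := {malg k[{cmonom I}]}.

HB.instance Definition _ := GRing.ComAlgebra.on sym_poisson.

Definition ps_var (i : I) : sym_poisson := << ucm i >>.

(* The linear embedding of g into PS(g), sending e_i to the i-th variable. *)
Definition ps_inj (v : g) : sym_poisson := lin_comb ps_var (basis_coord e v).

HB.instance Definition _ :=
  GRing.isLinear.Build k g sym_poisson _ ps_inj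
    (fun a v w => etrans (congr1 _ (linearP _ a v w)) (linearP _ a _ _)).

(* {p, q} = \sum_(i, j) dp/de_i * dq/de_j * [e_i, e_j] *)
Definition ps_br (p q : sym_poisson) : sym_poisson :=
  poly_der (fun i => poly_der (fun j => ps_inj (lie (e i) (e j))) q) p.

Lemma ps_inj_basis i : ps_inj (e i) = ps_var i.
Proof.
rewrite /ps_inj (_ : e i = lin_comb e << i >>) ?lin_combK ?lin_combU ?scale1r //.
Qed.

Let A : comAlgType k := sym_poisson.
Let der : (I -> A) -> A -> A := @poly_der k I.
Let der_linear a : linear (der a).
Proof. exact: linearP. Qed.

Let c (i j : I) : A := ps_inj (lie (e i) (e j)).

Lemma ps_br_gen i j : ps_br (ps_var i) (ps_var j) = ps_inj (lie (e i) (e j)).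
Proof. exact: (@gbrXX k A I ps_var der (@poly_derX k I) c). Qed.

Let br_linearr :=
  @gbr_linearr k A I ps_var der (@mpoly_ind k I) der_linear (@poly_derM k I)
    (@poly_derX k I) c.

Let c_alt i : c i i = 0.
Proof. by rewrite /c liexx linear0. Qed.

Let c_anti i j : c i j = - c j i.
Proof. by rewrite /c lieC linearN. Qed.

Let br_linearl := @gbr_linearl k A I der der_linear c.

Let br_var_inj i v : ps_br (ps_var i) (ps_inj v) = ps_inj (lie (e i) v).
Proof.
apply: (basis_ext (e := e) (F := ps_br (ps_var i) \o ps_inj)
          (G := ps_inj \o lie (e i))) v => [x v w|x v w|j] /=.
- by rewrite linearP; exact: br_linearr.
- by rewrite lie_linearr linearP.
- by rewrite ps_inj_basis; exact: ps_br_gen.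
Qed.

Lemma ps_br_inj v w : ps_br (ps_inj v) (ps_inj w) = ps_inj (lie v w).
Proof.
apply: (basis_ext (e := e) (F := fun v => ps_br (ps_inj v) (ps_inj w))
          (G := fun v => ps_inj (lie v w))) v => [x u v|x u v|j] /=.
- by rewrite linearP; exact: br_linearl.
- by rewrite lie_linearl linearP.
- by rewrite ps_inj_basis; exact: br_var_inj.
Qed.

Let c_jacobi i j l :
  ps_br (ps_var i) (c j l) + ps_br (ps_var j) (c l i)
  + ps_br (ps_var l) (c i j) = 0.
Proof.
apply: (etrans (congr2 +%R (congr2 +%R (br_var_inj _ _) (br_var_inj _ _))
                           (br_var_inj _ _))).
by rewrite -!linearD lie_jacobi linear0.
Qed.

HB.instance Definition _ := Lmodule_isLieAlgebra.Build k sym_poisson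
  br_linearl br_linearr
  (@gbrxx k A I ps_var der (@mpoly_ind k I) der_linear (@poly_derM k I)
    (@poly_derX k I) c c_alt c_anti)
  (@gbr_jacobi k A I ps_var der (@mpoly_ind k I) der_linear (@poly_derM k I)
    (@poly_derX k I) c c_anti c_jacobi).

HB.instance Definition _ := isPoissonAlgebra.Build k sym_poisson
  (fun p q r => @gbrMr k A I ps_var der (@mpoly_ind k I) der_linear
    (@poly_derM k I) (@poly_derX k I) c q r p).

Lemma ps_inj_lie v w : ps_inj (lie v w) = lie (ps_inj v) (ps_inj w).
Proof. exact/esym/ps_br_inj. Qed.

End SymPoisson.

(** * Free Poisson algebras *)

(* PS(g) is independent of the basis of g up to isomorphism; here an arbitrary
   one is chosen. *)
Definition free_poisson (k : fieldType) (X : Type) : poissonAlgType k :=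
  sym_poisson (hamel_basis (free_lie k X)).

Definition fp_gen (k : fieldType) (X : Type) (x : X) : free_poisson k X :=
  ps_inj (hamel_basis (free_lie k X)) (flie_gen k x).

(* [S] is, as a Poisson algebra, the free Poisson algebra with free generators
   [w x] for x in X. *)
Definition free_poisson_on (k : fieldType) (X : Type) (Q : poissonAlgType k)
    (S : set Q) (w : X -> Q) : Prop :=
  exists phi : free_poisson k X -> Q,
    [/\ poisson_hom phi, injective phi, forall x, phi (fp_gen k x) = w x
      & range phi = S].

(* Main.v *)
From HB Require Import structures.
Require Import Defs.
From mathcomp Require Import all_boot all_algebra.
From mathcomp Require Import finmap ring separable.
From mathcomp Require Import boolp classical_sets.
From mathcomp.multinomials Require Import monalg.

(** The point is the Freiheitssatz: the Poisson ideal (f) meets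
k{z_1, ..., z_(m-1)} only in 0.  Map k{z_1, ..., z_m} to the polynomial algebra
in finitely many conjugate coordinates x_w, p_w and all partial derivatives of
an indeterminate function Y, with the canonical bracket, sending z_m to Y and
z_i (i < m) to Hamiltonians that are linear in both x and p.  In this algebra
the Poisson ideal of the image F of f lies in the differential ideal of F.

Since the derivatives commute, F = 0 is a single partial differential equation
for Y, and no compatibility condition arises: after replacing F by a separable
factor with respect to its leading derivative, the successive derivatives of
the equation can be solved one after the other for the derivatives of the
leader.  Hence, if F involves Y, its differential ideal contains no nonzero
polynomial in x and p.

It remains to choose the Hamiltonians so that a given nonzero element is not
killed.  Let z_i act on the span of the words of length at most c by left
multiplication.  By the Dynkin-Specht-Wever identity (this uses
characteristic 0), evaluating at the empty word and bracketing recovers each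
Lie element of degree at most c. *)

Set Implicit Arguments.
Unset Strict Implicit.
Unset Printing Implicit Defensive.

Import GRing.Theory.
Local Open Scope ring_scope.
Local Open Scope classical_set_scope.

(** * Polynomials in infinitely many variables *)

Section MonomialWeight.
Variables (I : choiceType) (w : I -> nat).
Implicit Types m : {cmonom I}.

Definition mwt m : nat := (\sum_(i <- finsupp m) m i * w i)%N.

Lemma mwtEw m (d : {fset I}) : (finsupp m `<=` d)%fset ->
  mwt m = (\sum_(i <- d) m i * w i)%N.
Proof.
move=> le; rewrite [LHS](big_fset_incl _ le) => //= i _.
by rewrite -cmE_eq0 => /eqP ->; rewrite mul0n.
Qed.

Lemma mwt1 : mwt mone = 0%N.
Proof. by rewrite /mwt mdom1 big_seq_fset0. Qed.

Lemma mwtU i : mwt (ucm i) = w i.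
Proof. by rewrite /mwt mdomU big_seq_fset1 ucmE eqxx mul1n. Qed.

Lemma mwtM m m' : mwt (mmul m m') = (mwt m + mwt m')%N.
Proof.
pose d := (finsupp m `|` finsupp m')%fset.
rewrite !(@mwtEw _ d) ?mdomD ?fsubsetUl ?fsubsetUr // -big_split /=.
by apply: eq_bigr => i _; rewrite cmM mulnDl.
Qed.

Lemma mwt_gt0 m : (forall i, 0 < w i)%N -> m != mone -> (0 < mwt m)%N.
Proof.
move=> w0 m1; rewrite lt0n; apply: contra m1 => /eqP h; apply/cmP => i.
rewrite cm1; apply/eqP; rewrite cmE_eq0; apply/negP => im.
move: h; rewrite /mwt (big_fsetD1 i) //= => /eqP; rewrite addn_eq0 muln_eq0.
by rewrite cmE_eq0 im /= => /andP[/eqP h _]; move: (w0 i); rewrite h.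
Qed.

End MonomialWeight.

(** With a base [B] exceeding every exponent that occurs, the weights [B ^ index i d] read an
    exponent vector as a string of base-[B] digits, so distinct monomials get distinct weights. This
    serves both Kronecker substitution and the ranking of derivatives. *)
Lemma exists_separating_weight (I : choiceType) (s : seq {cmonom I}) :
  exists2 w : I -> nat, (forall i, 0 < w i)%N &
    {in s &, injective (mwt w)}.
Proof.
pose d := (\bigcup_(m <- s) finsupp m)%fset.
pose B := (\max_(m <- s) \max_(i <- finsupp m) m i).+1.
have hd m : m \in s -> (finsupp m `<=` d)%fset by move=> ms; apply: bigfcup_sup.
have hB m i : m \in s -> (m i < B)%N.
  move=> ms; rewrite ltnS.
  have [im|] := boolP (i \in finsupp m); last by rewrite -cmE_eq0 => /eqP ->.
  apply: leq_trans (leq_bigmax_seq (P := xpredT)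
    (F := fun m : {cmonom I} => \max_(i <- finsupp m) m i)%N m ms isT).
  exact: (leq_bigmax_seq (P := xpredT) (F := fun i => m i) i im isT).
exists (fun i => B ^ index i d)%N => [i|m m' ms m's]; first by rewrite expn_gt0.
rewrite !(@mwtEw _ _ _ d) ?hd // => h.
suff hd' : {in (d : seq I), m =1 m'}.
  apply/eqP/cmP => i; have [/hd' //|id] := boolP (i \in (d : seq I)).
  have out m0 : m0 \in s -> m0 i = 0%N.
    move=> m0s; apply/eqP; rewrite cmE_eq0; apply: contra id.
    exact: (fsubsetP (hd _ m0s)).
  by rewrite !out.
have : uniq (d : seq I) by exact: fset_uniq.
move: (d : seq I) h => l; elim: l => [|i l IH] //= h /andP[il ul].
(* Splits off the lowest digit: reduction modulo [B] recovers the exponent of [i], and the quotient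
   is the same sum over the shorter list. *)
have aux m0 : (\sum_(j <- i :: l) m0 j * B ^ index j (i :: l) =
    m0 i + B * \sum_(j <- l) m0 j * B ^ index j l)%N.
  rewrite big_cons /= eqxx muln1 big_distrr /=; congr addn.
  apply: eq_big_seq => j jl /=; case: eqP => [ij|_]; first by rewrite ij jl in il.
  by rewrite expnS mulnCA.
move: h; rewrite !aux => h.
have hi : m i = m' i.
  move/(congr1 (modn^~ B)): h.
  by rewrite ![(B * _)%N]mulnC ![(_ + _ * B)%N]addnC !modnMDl !modn_small ?hB.
move: h; rewrite hi => /addnI /eqP; rewrite eqn_pmul2l // => /eqP /IH h.
by move=> j; rewrite inE => /predU1P[->//|]; exact: h.
Qed.

(** * Evaluation morphisms and subalgebras generated by variables *)

Section Evaluation.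
Variables (k : fieldType) (I : choiceType) (B : comNzRingType).
Local Notation P := {malg k[{cmonom I}]}.
Variables (f : {rmorphism k -> B}) (h : I -> B).
Implicit Types (m : {cmonom I}) (p q : P).

Definition mon_eval m : B := \prod_(i <- finsupp m) h i ^+ m i.

Lemma mon_evalEw m (d : {fset I}) : (finsupp m `<=` d)%fset ->
  mon_eval m = \prod_(i <- d) h i ^+ m i.
Proof.
move=> le; rewrite [LHS](big_fset_incl _ le) => //= i _.
by rewrite -cmE_eq0 => /eqP ->; rewrite expr0.
Qed.

Fact mon_eval_is_mmorphism : mmorphism mon_eval.
Proof.
split; last by rewrite /mon_eval mdom1 big_seq_fset0.
move=> m m'; pose d := (finsupp m `|` finsupp m')%fset.
rewrite !(@mon_evalEw _ d) ?mdomD ?fsubsetUl ?fsubsetUr // -big_split /=.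
by apply: eq_bigr => i _; rewrite cmM exprD.
Qed.

HB.instance Definition _ := isMultiplicative.Build _ _ mon_eval
  mon_eval_is_mmorphism.

Definition mp_eval : P -> B := mmap f mon_eval.

HB.instance Definition _ := GRing.RMorphism.on mp_eval.

Lemma mp_evalD p q : mp_eval (p + q) = mp_eval p + mp_eval q.
Proof. exact: rmorphD. Qed.

Lemma mp_evalM p q : mp_eval (p * q) = mp_eval p * mp_eval q.
Proof. exact: rmorphM. Qed.

Lemma mp_evalU m : mp_eval << m >> = mon_eval m.
Proof. by rewrite /mp_eval mmapU [X in X * _](rmorph1 f) mul1r. Qed.

Lemma mp_evalX i : mp_eval << ucm i >> = h i.
Proof. by rewrite mp_evalU /mon_eval mdomU big_seq_fset1 ucmE eqxx. Qed.

Lemma mp_evalC c : mp_eval c%:A = f c.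
Proof. by rewrite -[c%:A]mul_malgC mulr1 /mp_eval mmapC. Qed.

Lemma mp_evalZ c p : mp_eval (c *: p) = f c * mp_eval p.
Proof. by rewrite -mulr_algl rmorphM /= mp_evalC. Qed.

End Evaluation.

Lemma cmonom_ind (J : choiceType) (Q : {cmonom J} -> Prop) :
  Q mone -> (forall m a, Q m -> Q (mmul m (ucm a))) -> forall m, Q m.
Proof.
move=> Q1 QM m; elim: {m}(mdeg m) {-2}m (erefl (mdeg m)) => [|n IHn] m hm.
  by rewrite (mdeg_eq0I hm).
have [i mi] : exists i, (0 < m i)%N.
  apply: contrapT => h; suff m1 : m = mone by rewrite m1 mdeg1 in hm.
  apply/eqP/cmP => i; rewrite cm1; apply/eqP; rewrite -leqn0 leqNgt.
  by apply/negP => mi; apply: h; exists i.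
have mE : m = mmul (divcm m (ucm i)) (ucm i).
  apply/eqP/cmP => j; rewrite cmM divcmE ucmE.
  by have [<-|_] := eqVneq i j; rewrite ?subn0 ?addn0 // subnK.
rewrite mE; apply: QM; apply: IHn.
by move: hm; rewrite {1}mE mdegM mdegU addn1 => -[].
Qed.

Lemma mp_rmorph_ext (k : fieldType) (I : choiceType) (B : comNzRingType)
    (phi psi : {rmorphism {malg k[{cmonom I}]} -> B}) :
  (forall c : k, phi c%:A = psi c%:A) ->
  (forall i, phi << ucm i >> = psi << ucm i >>) -> phi =1 psi.
Proof.
move=> hC hX; elim/mpoly_ind => [c|i|p q IHp IHq|p q IHp IHq] //.
- by rewrite !rmorphD IHp IHq.
- by rewrite !rmorphM IHp IHq.
Qed.

Section InVars.
Variables (k : fieldType) (I : choiceType).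
Local Notation P := {malg k[{cmonom I}]}.
Implicit Types (S : I -> Prop) (p q : P).

(** The subalgebra generated by the variables in [S], in inductive form so that stability under
    morphisms and derivations is proved on generators. [in_vars_supp] and [in_vars_msupp] link it to
    the variables that actually occur. *)
Inductive in_vars S : P -> Prop :=
  | in_varsC c : in_vars S c%:A
  | in_varsX i : S i -> in_vars S << ucm i >>
  | in_varsD p q : in_vars S p -> in_vars S q -> in_vars S (p + q)
  | in_varsM p q : in_vars S p -> in_vars S q -> in_vars S (p * q).

Lemma in_vars1 S : in_vars S 1.
Proof. by rewrite -[1]scale1r; exact: in_varsC. Qed.

Lemma in_vars0 S : in_vars S 0.
Proof. by rewrite -[0 : P](scale0r 1); exact: in_varsC. Qed.

Lemma in_varsZ S c p : in_vars S p -> in_vars S (c *: p).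
Proof. by move=> Sp; rewrite -mulr_algl; apply: in_varsM => //; exact: in_varsC. Qed.

Lemma in_varsMn S p n : in_vars S p -> in_vars S (p *+ n).
Proof. by rewrite -scaler_nat; exact: in_varsZ. Qed.

Lemma in_vars_sum S (J : Type) (r : seq J) (Q : pred J) (F : J -> P) :
  (forall j, Q j -> in_vars S (F j)) -> in_vars S (\sum_(j <- r | Q j) F j).
Proof.
move=> h; elim/big_rec: _ => [|j p Qj Sp]; first exact: in_vars0.
by apply: in_varsD => //; exact: h.
Qed.

Lemma in_varsS S S' p : (forall i, S i -> S' i) -> in_vars S p -> in_vars S' p.
Proof.
move=> SS'; elim=> [c|i Si|{}p q _ IHp _ IHq|{}p q _ IHp _ IHq].
- exact: in_varsC.
- by apply: in_varsX; exact: SS'.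
- exact: in_varsD.
- exact: in_varsM.
Qed.

Lemma in_vars_mon S (m : {cmonom I}) :
  (forall i, (0 < m i)%N -> S i) -> in_vars S << m >>.
Proof.
elim/cmonom_ind: m => [_|m a IHm Sm]; first exact: in_vars1.
rewrite -mulUU; apply: in_varsM.
  by apply: IHm => i mi; apply: Sm; rewrite cmM ltn_addr.
by apply/in_varsX/Sm; rewrite cmM ucmE eqxx addn1.
Qed.

Lemma in_vars_supp p :
  in_vars (fun i => exists2 m : {cmonom I}, m \in msupp p & (0 < m i)%N) p.
Proof.
rewrite {2}(monalgE p) big_seq; apply: in_vars_sum => m mp.
have -> : << p@_m *g m >> = p@_m *: << m >> :> P.
  by rewrite -mul_malgC malgM_def fgmulUU mulr1 mul1m.
by apply/in_varsZ/in_vars_mon => i mi; exists m.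
Qed.

Lemma in_vars_ext (B : comNzRingType) S (phi psi : {rmorphism P -> B}) p :
  (forall c : k, phi c%:A = psi c%:A) ->
  (forall i, S i -> phi << ucm i >> = psi << ucm i >>) ->
  in_vars S p -> phi p = psi p.
Proof.
move=> hC hX; elim=> [c|i Si|{}p q _ IHp _ IHq|{}p q _ IHp _ IHq] //.
- exact: hX.
- by rewrite !rmorphD IHp IHq.
- by rewrite !rmorphM IHp IHq.
Qed.

End InVars.

(** In characteristic 0 the images of the first [size p] natural numbers are distinct, one more than
    the degree of [p], so they cannot all be roots. *)
Lemma exists_nonroot (k : fieldType) (p : {poly k}) : [pchar k] =i pred0 -> p != 0 ->
  exists t, p.[t] != 0.
Proof.
move=> /pcharf0P k0 p0; apply: contrapT => h.
suff : (size [seq i%:R : k | i <- iota 0 (size p)] < size p)%N.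
  by rewrite size_map size_iota ltnn.
apply: max_poly_roots => //.
  apply/allP => x _; apply/negPn/negP => hx; apply: h; exists x.
  by rewrite -rootE.
rewrite map_inj_uniq ?iota_uniq // => i j.
wlog le_ij : i j / (i <= j)%N => [hw ij|].
  by have /orP[/hw->//|/hw->] := leq_total i j.
move=> /esym/eqP; rewrite -subr_eq0 -natrB // k0 subn_eq0 => le_ji.
by apply/eqP; rewrite eqn_leq le_ij.
Qed.

(** * Integrality and nonvanishing points *)

Section PolynomialDomain.
Variables (k : fieldType) (I : choiceType).
Local Notation P := {malg k[{cmonom I}]}.
Implicit Types p q : P.

(* Kronecker substitution: [X_i |-> T ^ (w i)] *)
Definition kronecker (w : I -> nat) : P -> {poly k} :=
  mp_eval polyC (fun i => 'X^(w i)).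

HB.instance Definition _ w := GRing.RMorphism.on (kronecker w).

Lemma kroneckerE w p :
  kronecker w p = \sum_(m <- msupp p) p@_m *: 'X^(mwt w m).
Proof.
rewrite /kronecker /mp_eval mmapE; apply: eq_bigr => m _.
rewrite -mul_polyC /= /mon_eval; congr (_ * _).
rewrite /mwt; elim/big_rec2: _ => [|i n x _ ->]; first by rewrite expr0.
by rewrite -exprM mulnC -exprD.
Qed.

(** Injectivity of the weight prevents two monomials from landing on the same power of ['X], so no
    coefficient can cancel. *)
Lemma kronecker_neq0 w p : {in msupp p &, injective (mwt w)} -> p != 0 ->
  kronecker w p != 0.
Proof.
move=> inj_w p0; have [m mp] : exists m, m \in msupp p.
  apply: contrapT => h; case/eqP: p0; apply/malgP => m; rewrite mcoeff0.
  by rewrite mcoeff_outdom //; apply/negP => mp; apply: h; exists m.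
apply/eqP => /(congr1 (fun r : {poly k} => r`_(mwt w m))).
rewrite coef0 kroneckerE coef_sum (big_fsetD1 m) //= coefZ coefXn eqxx mulr1.
rewrite big1_fset ?addr0 => [/eqP|m']; first by rewrite mcoeff_eq0 mp.
rewrite in_fsetD1 => /andP[m'm m'p] _; rewrite coefZ coefXn.
case: eqP => [h|]; last by rewrite mulr0.
by rewrite (inj_w _ _ mp m'p h) eqxx in m'm.
Qed.

(** One weight separating the monomials of both factors moves the question to [{poly k}], which is a
    domain. *)
Fact malg_cmonom_mulf_eq0 p q : p * q = 0 -> (p == 0) || (q == 0).
Proof.
move=> pq0; apply/contraT; rewrite negb_or => /andP[p0 q0].
have [w _ inj_w] := exists_separating_weight (msupp p ++ msupp q : seq {cmonom I}).
have : kronecker w p * kronecker w q != 0.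
  by rewrite mulf_neq0 // kronecker_neq0 // => m m' mp m'p; apply: inj_w;
    rewrite mem_cat ?mp ?m'p ?orbT.
by rewrite -rmorphM /= pq0 rmorph0 eqxx.
Qed.

(** Units and inverses are chosen classically; they only serve to equip the polynomial ring with the
    structure of an integral domain, over which gcds and Bezout relations become available. *)
Definition malg_unit : {pred P} := [pred p | `[< exists q, q * p = 1 >]].

Definition malg_inv p : P :=
  if pselect (exists q, q * p = 1) is left h then projT1 (cid h) else p.

Fact malg_mulVp : {in malg_unit, left_inverse 1 malg_inv *%R}.
Proof.
move=> p /asboolP h; rewrite /malg_inv.
by case: pselect => [h'|/(_ h)[]]; exact: (projT2 (cid h')).
Qed.

Fact malg_unitP p q : q * p = 1 -> p \in malg_unit.
Proof. by move=> h; apply/asboolP; exists q. Qed.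

Fact malg_inv_out : {in [predC malg_unit], malg_inv =1 id}.
Proof.
move=> p /asboolP h; rewrite /malg_inv.
by case: pselect => // h'; case: h.
Qed.

HB.instance Definition _ := GRing.ComNzRing_hasMulInverse.Build P
  malg_mulVp malg_unitP malg_inv_out.

HB.instance Definition _ := GRing.ComUnitRing_isIntegral.Build P
  malg_cmonom_mulf_eq0.

(** The point lies on the curve of a Kronecker substitution, at a parameter [t] that is not a root
    of the resulting univariate polynomial. *)
Lemma exists_nonzero_eval p : [pchar k] =i pred0 -> p != 0 ->
  exists h : I -> k, mp_eval idfun h p != 0.
Proof.
move=> k0 p0.
have [w _ inj_w] := exists_separating_weight (msupp p : seq {cmonom I}).
have [t pt] := exists_nonroot k0 (kronecker_neq0 inj_w p0).
exists (fun i => t ^+ w i); suff -> : mp_eval idfun (fun i => t ^+ w i) p =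
  (horner_eval t \o kronecker w) p by [].
apply: mp_rmorph_ext => [c|i].
  by rewrite /= /horner_eval /kronecker !mp_evalC hornerC.
by rewrite /= /horner_eval /kronecker !mp_evalX hornerXn.
Qed.

End PolynomialDomain.

(** * Universal properties *)

Section PoissonHom.
Variables (k : fieldType) (B B' : poissonAlgType k) (phi : B -> B').
Hypothesis hphi : poisson_hom phi.
Implicit Types x y : B.

Lemma phom_linear : linear phi. Proof. by case: hphi. Qed.

Lemma phom1 : phi 1 = 1. Proof. by case: hphi => _ []. Qed.

Lemma phomM x y : phi (x * y) = phi x * phi y.
Proof. by case: hphi => _ []. Qed.

Lemma phom_lie x y : phi (lie x y) = lie (phi x) (phi y).
Proof. by case: hphi. Qed.

Lemma phomD x y : phi (x + y) = phi x + phi y.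
Proof. by have := phom_linear 1 x y; rewrite !scale1r. Qed.

Lemma phom0 : phi 0 = 0.
Proof. by apply: (addrI (phi 0)); rewrite -phomD !addr0. Qed.

Lemma phomZ a x : phi (a *: x) = a *: phi x.
Proof. by have := phom_linear a x 0; rewrite phom0 !addr0. Qed.

Lemma phomB x y : phi (x - y) = phi x - phi y.
Proof. by rewrite phomD -scaleN1r phomZ scaleN1r. Qed.

Lemma phom_range : poisson_subalgebra (range phi).
Proof.
split.
- by exists 1 => //; exact: phom1.
- by move=> _ _ [x _ <-] [y _ <-]; exists (x + y) => //; exact: phomD.
- by move=> a _ [x _ <-]; exists (a *: x) => //; exact: phomZ.
- by move=> _ _ [x _ <-] [y _ <-]; exists (x * y) => //; exact: phomM.
- by move=> _ _ [x _ <-] [y _ <-]; exists (lie x y) => //; exact: phom_lie.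
Qed.

Lemma phom_preimage (S : set B') :
  poisson_subalgebra S -> poisson_subalgebra (phi @^-1` S).
Proof.
move=> hS; split=> /=.
- by rewrite phom1; exact: psub1.
- by move=> x y; rewrite phomD; exact: psubD.
- by move=> a x; rewrite phomZ; exact: psubZ.
- by move=> x y; rewrite phomM; exact: psubM.
- by move=> x y; rewrite phom_lie; exact: psub_lie.
Qed.

Lemma phom_ideal (J : set B') : poisson_ideal J -> poisson_ideal (phi @^-1` J).
Proof.
move=> hJ; split=> /=.
- by rewrite phom0; exact: pideal0.
- by move=> x y; rewrite phomD; exact: pidealD.
- by move=> a x; rewrite phomZ; exact: pidealZ.
- by move=> b x; rewrite phomM; exact: pidealM.
- by move=> b x; rewrite phom_lie; exact: pideal_lie.
Qed.

End PoissonHom.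

Lemma phom_comp (k : fieldType) (B1 B2 B3 : poissonAlgType k)
    (psi : B2 -> B3) (phi : B1 -> B2) :
  poisson_hom psi -> poisson_hom phi -> poisson_hom (psi \o phi).
Proof.
move=> hpsi hphi; split=> [a x y /=||x y /=].
- by rewrite (phom_linear hphi) (phom_linear hpsi).
- split=> [|x y] /=; first by rewrite (phom1 hphi) (phom1 hpsi).
  by rewrite (phomM hphi) (phomM hpsi).
- by rewrite (phom_lie hphi) (phom_lie hpsi).
Qed.

Lemma phom_equalizer (k : fieldType) (B B' : poissonAlgType k)
    (phi psi : B -> B') : poisson_hom phi -> poisson_hom psi ->
  poisson_subalgebra [set x | phi x = psi x].
Proof.
move=> hphi hpsi; split=> /=.
- by rewrite (phom1 hphi) (phom1 hpsi).
- by move=> x y hx hy; rewrite (phomD hphi) (phomD hpsi) hx hy.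
- by move=> a x hx; rewrite (phomZ hphi) (phomZ hpsi) hx.
- by move=> x y hx hy; rewrite (phomM hphi) (phomM hpsi) hx hy.
- by move=> x y hx hy; rewrite (phom_lie hphi) (phom_lie hpsi) hx hy.
Qed.

Lemma ps_ind (k : fieldType) (g : lieAlgType k) (e : basis g)
    (Q : sym_poisson e -> Prop) :
  (forall c : k, Q c%:A) -> (forall i, Q (ps_var i)) ->
  (forall p q, Q p -> Q q -> Q (p + q)) ->
  (forall p q, Q p -> Q q -> Q (p * q)) -> forall p, Q p.
Proof. exact: mpoly_ind. Qed.

Lemma lie1r (k : fieldType) (A : poissonAlgType k) (x : A) : lie x 1 = 0.
Proof.
have := lie_leibniz x 1 1; rewrite !mul1r mulr1 => e1.
by apply: (addrI (lie x 1)); rewrite -e1 addr0.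
Qed.

Lemma lie_leibnizl (k : fieldType) (A : poissonAlgType k) (x y z : A) :
  lie (x * y) z = lie x z * y + x * lie y z.
Proof.
by rewrite lieC lie_leibniz opprD -mulNr -mulrN -!lieC.
Qed.

(** Both sides of the bracket identity obey the Leibniz rule in each argument, so a morphism of
    algebras respects brackets as soon as it does so on generators. *)
Lemma poisson_hom_generators (k : fieldType) (A B : poissonAlgType k) (I : Type)
    (X : I -> A) (phi : A -> B) :
  (forall Q : A -> Prop, (forall c : k, Q c%:A) -> (forall i, Q (X i)) ->
    (forall p q, Q p -> Q q -> Q (p + q)) ->
    (forall p q, Q p -> Q q -> Q (p * q)) -> forall p, Q p) ->
  (forall c : k, phi c%:A = c%:A) -> {morph phi : x y / x + y} ->
  {morph phi : x y / x * y} ->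
  (forall i j, phi (lie (X i) (X j)) = lie (phi (X i)) (phi (X j))) ->
  poisson_hom phi.
Proof.
move=> A_ind phiC phiD phiM phiX.
have phi0 : phi 0 = 0 by apply: (addrI (phi 0)); rewrite -phiD !addr0.
have phi_lieX i q : phi (lie (X i) q) = lie (phi (X i)) (phi q).
  elim/A_ind: q => [c|//|p q IHp IHq|p q IHp IHq].
  - by rewrite phiC !lieZr !lie1r !scaler0 phi0.
  - by rewrite lieDr !phiD IHp IHq lieDr.
  - by rewrite lie_leibniz phiD !phiM IHp IHq lie_leibniz.
split=> [a p q||p q].
- by rewrite phiD -mulr_algl phiM phiC mulr_algl.
- by split=> //; rewrite -[1 in LHS]scale1r phiC scale1r.
- elim/A_ind: p => [c|//|p p' IHp IHq|p p' IHp IHq].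
  + by rewrite lieC lieZr lie1r phiC [RHS]lieC lieZr lie1r !scaler0 !oppr0 phi0.
  + by rewrite lieDl !phiD IHp IHq lieDl.
  + by rewrite lie_leibnizl phiD !phiM IHp IHq lie_leibnizl.
Qed.

Section SymmetricPoissonUniversal.
Variables (k : fieldType) (g : lieAlgType k) (e : basis g) (B : poissonAlgType k).
Variable h : g -> B.
Hypotheses (h_linear : linear h) (h_lie : {morph h : x y / lie x y}).
Local Notation PS := (sym_poisson e).
Implicit Types p q : PS.

Definition ps_lift : PS -> B := mp_eval (in_alg B) (fun i => h (e i)).

Lemma ps_liftD p q : ps_lift (p + q) = ps_lift p + ps_lift q.
Proof. exact: rmorphD. Qed.

Lemma ps_liftM p q : ps_lift (p * q) = ps_lift p * ps_lift q.
Proof. exact: rmorphM. Qed.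

Lemma ps_liftC c : ps_lift c%:A = c%:A.
Proof. exact: mp_evalC. Qed.

Lemma ps_liftX i : ps_lift (ps_var i) = h (e i).
Proof. exact: mp_evalX. Qed.

Lemma ps_lift_linear : linear ps_lift.
Proof.
by move=> a p q; rewrite ps_liftD -mulr_algl ps_liftM ps_liftC mulr_algl.
Qed.

Lemma ps_lift_inj v : ps_lift (ps_inj e v) = h v.
Proof.
apply: (basis_ext (e := e) (F := ps_lift \o ps_inj e) (G := h)) v => // [a v w|i] /=.
  by rewrite linearP ps_lift_linear.
by rewrite ps_inj_basis ps_liftX.
Qed.

Lemma ps_lift_hom : poisson_hom ps_lift.
Proof.
apply: (poisson_hom_generators (X := @ps_var k g e)).
- exact: ps_ind.
- exact: ps_liftC.
- exact: ps_liftD.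
- exact: ps_liftM.
- move=> i j; apply: (etrans (congr1 ps_lift (ps_br_gen i j))).
  apply: (etrans (ps_lift_inj _)); apply: (etrans (h_lie _ _)).
  exact: (congr2 lie (esym (ps_liftX i)) (esym (ps_liftX j))).
Qed.

End SymmetricPoissonUniversal.

Lemma flie_generated (k : fieldType) (X : Type) (B : poissonAlgType k)
    (S : set B) (j : free_lie k X -> B) :
  poisson_subalgebra S -> linear j -> {morph j : x y / lie x y} ->
  (forall x, S (j (flie_gen k x))) -> forall v, S (j v).
Proof.
move=> hS j_lin j_lie Sgen.
have jD v w : j (v + w) = j v + j w by have := j_lin 1 v w; rewrite !scale1r.
have j0 : j 0 = 0 by apply: (addrI (j 0)); rewrite -jD !addr0.
have jZ a v : j (a *: v) = a *: j v by have := j_lin a v 0; rewrite j0 !addr0.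
elim/flie_class_ind=> s.
elim: s => [x||s IHs|s IHs t IHt|a s IHs|s IHs t IHt].
- exact: Sgen.
- rewrite -[flie_class _]/(0 : free_lie k X) j0 -(scale0r 1).
  by apply: (psubZ hS); exact: psub1.
- rewrite -flie_oppE -[flie_opp _]/(- (flie_class s : free_lie k X)).
  by rewrite -scaleN1r jZ; exact: (psubZ hS).
- rewrite -flie_addE -[flie_add _ _]/(flie_class s + flie_class t : free_lie k X).
  by rewrite jD; exact: (psubD hS).
- rewrite -flie_scaleE -[flie_scale _ _]/(a *: flie_class s : free_lie k X).
  by rewrite jZ; exact: (psubZ hS).
- rewrite -flie_brE.
  rewrite -[flie_br _ _]/(lie (flie_class s : free_lie k X) (flie_class t)).
  by rewrite j_lie; exact: (psub_lie hS).
Qed.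

Section FreePoissonUniversal.
Variables (k : fieldType) (X : Type).
Local Notation FP := (free_poisson k X).

(** The polynomial variables come from a basis that is not explicit, so they are reached as images
    of elements of the free Lie algebra, all of which lie in [S]. *)
Lemma fp_generated (S : set FP) : poisson_subalgebra S ->
  (forall x, S (fp_gen k x)) -> forall p, S p.
Proof.
move=> hS Sgen.
pose j : free_lie k X -> FP := ps_inj (hamel_basis (free_lie k X)).
have j_lin : linear j by exact: linearP.
have j_lie : {morph j : x y / lie x y} by exact: ps_inj_lie.
have S_inj := flie_generated hS j_lin j_lie Sgen.
apply: ps_ind.
- by move=> c; apply: (psubZ hS); exact: psub1.
- by move=> i; rewrite -ps_inj_basis; exact: S_inj.
- exact: (psubD hS).
- exact: (psubM hS).
Qed.

Variable B : poissonAlgType k.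

Lemma fp_lift_exists (u : X -> B) :
  exists2 phi : FP -> B, poisson_hom phi & forall x, phi (fp_gen k x) = u x.
Proof.
have [h [[h_lin h_lie h_gen] _]] := free_lieP u.
exists (ps_lift (e := hamel_basis _) h); first exact: ps_lift_hom.
by move=> x; rewrite /fp_gen ps_lift_inj.
Qed.

Lemma fp_hom_ext (phi psi : FP -> B) : poisson_hom phi -> poisson_hom psi ->
  (forall x, phi (fp_gen k x) = psi (fp_gen k x)) -> phi =1 psi.
Proof. by move=> hphi hpsi; apply: fp_generated; exact: phom_equalizer. Qed.

Lemma fp_hom_range (phi : FP -> B) : poisson_hom phi ->
  range phi = gen_subalgebra (range (fun x => phi (fp_gen k x))).
Proof.
move=> hphi; apply/seteqP; split=> [_ [p _ <-] S hS genS|q]; last first.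
  by apply; [exact: phom_range|move=> _ [x _ <-]; exists (fp_gen k x)].
apply: (fp_generated (S := phi @^-1` S)) p => [|x]; first exact: phom_preimage.
by apply: genS; exists x.
Qed.

End FreePoissonUniversal.

(** * Symplectic differential polynomials *)

Lemma derivation_alg (k : fieldType) (A : comAlgType k) (D : {linear A -> A})
    (c : k) :
  (forall p q, D (p * q) = D p * q + p * D q) -> D c%:A = 0.
Proof.
move=> DM.
rewrite linearZ /=; suff -> : D 1 = 0 by rewrite scaler0.
have := DM 1 1; rewrite !mul1r mulr1 => h.
by apply: (addrI (D 1)); rewrite -h addr0.
Qed.

(** The commutator of two derivations is a derivation, hence vanishes once it vanishes on
    generators. *)
Lemma derivation_comm (k : fieldType) (A : comAlgType k) (I : Type) (X : I -> A)
    (D D' : {linear A -> A}) p :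
  (forall Q : A -> Prop, (forall c : k, Q c%:A) -> (forall i, Q (X i)) ->
    (forall p q, Q p -> Q q -> Q (p + q)) ->
    (forall p q, Q p -> Q q -> Q (p * q)) -> forall p, Q p) ->
  (forall p q, D (p * q) = D p * q + p * D q) ->
  (forall p q, D' (p * q) = D' p * q + p * D' q) ->
  (forall i, D (D' (X i)) = D' (D (X i))) -> D (D' p) = D' (D p).
Proof.
move=> A_ind DM D'M h; elim/A_ind: p => [c|//|p q IHp IHq|p q IHp IHq].
- by rewrite !derivation_alg // !linear0.
- by rewrite !linearD /= IHp IHq.
- rewrite DM D'M !linearD /= !DM !D'M IHp IHq -!addrA.
  by congr (_ + _); rewrite addrCA.
Qed.

Section SymplecticBracket.
Variables (k : fieldType) (A : comAlgType k) (W : finType).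
Local Notation J := (W + W)%type.
Variable d : J -> {linear A -> A}.
Hypothesis dM : forall a x y, d a (x * y) = d a x * y + x * d a y.
Hypothesis dC : forall a b x, d a (d b x) = d b (d a x).
Implicit Types (a b : J) (x y z : A).

Definition swap_pair a : J :=
  match a with inl w => inr w | inr w => inl w end.

Definition pair_sign a : k := if a is inl _ then 1 else -1.

Lemma swap_pairK : involutive swap_pair. Proof. by case. Qed.

Lemma pair_sign_swap a : pair_sign (swap_pair a) = - pair_sign a.
Proof. by case: a => w //=; rewrite opprK. Qed.

(** The canonical bracket: the terms [inl w] and [inr w] of the signed sum together form the usual
    difference of products of partial derivatives in a conjugate pair. *)
Definition symp_br x y : A :=
  \sum_a pair_sign a *: (d a x * d (swap_pair a) y).

Lemma symp_br_linearl c x y z :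
  symp_br (c *: x + y) z = c *: symp_br x z + symp_br y z.
Proof.
rewrite /symp_br scaler_sumr -big_split; apply: eq_bigr => a _ /=.
rewrite linearP mulrDl -scalerAl scalerDr !scalerA.
by rewrite [c * _]mulrC.
Qed.

Lemma symp_br_linearr c x y z :
  symp_br z (c *: x + y) = c *: symp_br z x + symp_br z y.
Proof.
rewrite /symp_br scaler_sumr -big_split; apply: eq_bigr => a _ /=.
rewrite linearP mulrDr -scalerAr scalerDr !scalerA.
by rewrite [c * _]mulrC.
Qed.

Lemma symp_brxx x : symp_br x x = 0.
Proof.
rewrite /symp_br big_sumType /= -big_split big1 //= => w _.
by rewrite scale1r scaleN1r mulrC subrr.
Qed.

Lemma symp_brM x y z : symp_br x (y * z) = symp_br x y * z + y * symp_br x z.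
Proof.
rewrite /symp_br mulr_suml mulr_sumr -big_split; apply: eq_bigr => a _ /=.
by rewrite dM mulrDr scalerDr -!scalerAl -!scalerAr mulrA mulrCA.
Qed.

(** The half of [symp_br x (symp_br y z)] in which the outer derivative falls on [y]. Since the
    derivations commute it is symmetric in [x] and [z], and the Jacobi sum, six terms [T] with
    signs, cancels in pairs. *)
Let T x y z := \sum_a \sum_b (pair_sign a * pair_sign b) *:
  (d a x * d (swap_pair a) (d b y) * d (swap_pair b) z).

Let T_sym x y z : T x y z = T z y x.
Proof.
rewrite /T exchange_big (reindex_inj (inv_inj swap_pairK)); apply: eq_bigr => a _.
rewrite (reindex_inj (inv_inj swap_pairK)); apply: eq_bigr => b _ /=.
rewrite !pair_sign_swap mulrNN [pair_sign b * _]mulrC; congr (_ *: _).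
by rewrite !swap_pairK dC mulrC -[RHS]mulrA [X in _ = _ * X]mulrC.
Qed.

Let br_br x y z : symp_br x (symp_br y z) = T x y z - T x z y.
Proof.
have -> : - T x z y = \sum_a \sum_b (pair_sign a * pair_sign b) *:
    (d a x * d (swap_pair a) (d (swap_pair b) z) * d b y).
  rewrite /T -sumrN; apply: eq_bigr => a _.
  rewrite (reindex_inj (inv_inj swap_pairK)) -sumrN; apply: eq_bigr => b _ /=.
  by rewrite pair_sign_swap mulrN scaleNr opprK swap_pairK.
rewrite /symp_br /T -big_split; apply: eq_bigr => a _ /=.
rewrite linear_sum mulr_sumr scaler_sumr -big_split; apply: eq_bigr => b _ /=.
rewrite linearZ dM /= -scalerAr scalerA -scalerDr mulrDr mulrA; congr (_ *: (_ + _)).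
by rewrite [d b y * _]mulrC mulrA.
Qed.

Lemma symp_br_jacobi x y z :
  symp_br x (symp_br y z) + symp_br y (symp_br z x) + symp_br z (symp_br x y) = 0.
Proof.
rewrite !br_br (T_sym z y x) (T_sym y z x) (T_sym y x z).
by rewrite !addrA !subrK subrr.
Qed.

End SymplecticBracket.

Section SymplecticPolynomials.
Variables (k : fieldType) (W : finType).
Local Notation J := (W + W)%type.

(* [inl (inl w)] and [inl (inr w)] are the conjugate coordinates x_w and p_w;
   [inr m] is the derivative of order [m] of an indeterminate function Y. *)
Definition symp_var : choiceType := (J + {cmonom J})%type.

Definition symp_poly : Type := {malg k[{cmonom symp_var}]}.

HB.instance Definition _ := GRing.ComAlgebra.on symp_poly.

Fact symp_key : unit. Proof. exact: tt. Qed.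

Definition coord_var : J -> symp_poly :=
  locked_with symp_key (fun a => << ucm (inl a : symp_var) >>).

Definition jet_var : {cmonom J} -> symp_poly :=
  locked_with symp_key (fun m => << ucm (inr m : symp_var) >>).

Lemma coord_varE a : coord_var a = << ucm (inl a : symp_var) >>.
Proof. by rewrite /coord_var unlock. Qed.

Lemma jet_varE m : jet_var m = << ucm (inr m : symp_var) >>.
Proof. by rewrite /jet_var unlock. Qed.

(** The total derivative on jets: coordinates are differentiated as independent variables, while the
    jets of Y are shifted by one order. *)
Let partial_def (a : J) : symp_poly -> symp_poly :=
  @poly_der k symp_var (fun v =>
    match v with inl b => (a == b)%:R | inr m => jet_var (mmul m (ucm a)) end).

Definition partial : J -> symp_poly -> symp_poly :=
  locked_with symp_key partial_def.

Let partialE : partial = partial_def. Proof. exact: unlock. Qed.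

Fact partial_is_linear a : linear (partial a).
Proof. by rewrite partialE; exact: linearP. Qed.

HB.instance Definition _ a :=
  GRing.isLinear.Build k symp_poly symp_poly _ (partial a) (partial_is_linear a).

Lemma symp_ind (Q : symp_poly -> Prop) :
  (forall c, Q c%:A) -> (forall a, Q (coord_var a)) -> (forall m, Q (jet_var m)) ->
  (forall p q, Q p -> Q q -> Q (p + q)) ->
  (forall p q, Q p -> Q q -> Q (p * q)) -> forall p, Q p.
Proof.
move=> QC Qx QY QD QM; apply: mpoly_ind => // -[a|m].
  by move: (Qx a); rewrite coord_varE.
by move: (QY m); rewrite jet_varE.
Qed.

Lemma partialM a p q : partial a (p * q) = partial a p * q + p * partial a q.
Proof. by rewrite partialE; exact: poly_derM. Qed.

Lemma partialC a c : partial a (c%:A : symp_poly) = 0.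
Proof. exact: (derivation_alg (D := partial a) c (partialM a)). Qed.

Lemma partial_coord a b : partial a (coord_var b) = (a == b)%:R.
Proof. by rewrite partialE coord_varE; exact: poly_derX. Qed.

Lemma partial_jet a m : partial a (jet_var m) = jet_var (mmul m (ucm a)).
Proof. by rewrite partialE [in LHS]jet_varE; exact: poly_derX. Qed.

Lemma partial_nat a n : partial a (n%:R : symp_poly) = 0.
Proof. by rewrite -scaler_nat; exact: partialC. Qed.

Lemma symp_var_ind (Q : symp_poly -> Prop) :
  (forall c, Q c%:A) ->
  (forall v : J + {cmonom J},
    Q (match v with inl a => coord_var a | inr m => jet_var m end)) ->
  (forall p q, Q p -> Q q -> Q (p + q)) ->
  (forall p q, Q p -> Q q -> Q (p * q)) -> forall p, Q p.
Proof.
by move=> QC QX QD QM; apply: symp_ind => // [a|m];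
  [exact: (QX (inl a))|exact: (QX (inr m))].
Qed.

Lemma partial_comm a b p : partial a (partial b p) = partial b (partial a p).
Proof.
apply: (derivation_comm (A := symp_poly) (D := partial a) (D' := partial b) p
  symp_var_ind) => [||[c|m]]; [exact: partialM|exact: partialM| |].
  by rewrite /= !partial_coord !partial_nat.
apply: (etrans (congr1 (partial a) (partial_jet b m))).
apply: (etrans (partial_jet a _)).
apply: esym; apply: (etrans (congr1 (partial b) (partial_jet a m))).
apply: (etrans (partial_jet b _)); congr jet_var.
by rewrite -!mulmA; congr mmul; exact: mulmC.
Qed.

HB.instance Definition _ := Lmodule_isLieAlgebra.Build k symp_poly
  (symp_br_linearl partial) (symp_br_linearr partial) (symp_brxx partial)
  (symp_br_jacobi partialM partial_comm).

HB.instance Definition _ := isPoissonAlgebra.Build k symp_poly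
  (symp_brM partialM).

Lemma symp_lieE (p q : symp_poly) :
  lie p q = \sum_a pair_sign k a *: (partial a p * partial (swap_pair a) q).
Proof. by []. Qed.

End SymplecticPolynomials.

(** * Differential ideals *)

Section DifferentialIdeal.
Variables (R : comNzRingType) (J : finType) (D : J -> R -> R).
Hypothesis DD : forall a x y, D a (x + y) = D a x + D a y.
Hypothesis DM : forall a x y, D a (x * y) = D a x * y + x * D a y.
Hypothesis DC : forall a b x, D a (D b x) = D b (D a x).
Implicit Types (m : {cmonom J}) (x y F : R).

Definition der_iter m x : R :=
  foldr (fun a y => iter (m a) (D a) y) x (enum J).

Lemma der_iter1 x : der_iter mone x = x.
Proof. by rewrite /der_iter; elim: (enum J) => //= a s ->; rewrite cm1. Qed.

(** [der_iter] applies the derivations in the order of [enum J]. Commutation carries the extra [D a]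
    to the place of [a], which occurs only once in the enumeration. *)
Lemma der_iterM m a x : der_iter (mmul m (ucm a)) x = D a (der_iter m x).
Proof.
have : a \in enum J by rewrite mem_enum.
have : uniq (enum J) by exact: enum_uniq.
rewrite /der_iter; elim: (enum J) => //= b s IHs /andP[bs us].
have iterC n y : iter n (D b) (D a y) = D a (iter n (D b) y).
  by elim: n => //= n ->; rewrite DC.
rewrite inE cmM ucmE; have [ab _|ab /= ains] := eqVneq a b; last first.
  by rewrite addn0 IHs.
rewrite addn1 /= ab; congr (D b (iter _ _ _)); elim: s bs {IHs us} => //= c s IHs.
rewrite inE negb_or => /andP[bc /IHs ->].
by rewrite cmM ucmE (negPf bc) addn0.
Qed.

Lemma der0 a : D a 0 = 0.
Proof. by apply: (addrI (D a 0)); rewrite -DD !addr0. Qed.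

Variable w : J -> nat.

(** A filtration of the differential ideal of [F] by weight. The bound is strict, so that the piece
    of index 0 is zero and [der_iter_mul_span] holds for the empty derivative. *)
Definition der_span F (n : nat) : set R := [set x |
  exists2 l : seq ({cmonom J} * R), all (fun t => mwt w t.1 < n)%N l &
    x = \sum_(t <- l) t.2 * der_iter t.1 F].

Lemma der_spanD F n x y :
  der_span F n x -> der_span F n y -> der_span F n (x + y).
Proof.
move=> [l hl ->] [l' hl' ->]; exists (l ++ l'); first by rewrite all_cat hl.
by rewrite big_cat.
Qed.

Lemma der_spanM F n x y : der_span F n y -> der_span F n (x * y).
Proof.
move=> [l hl ->]; exists [seq (t.1, x * t.2) | t <- l]; first by rewrite all_map.
by rewrite big_map mulr_sumr; apply: eq_bigr => t _; rewrite mulrA.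
Qed.

Lemma der_span0 F n : der_span F n 0.
Proof. by exists [::] => //; rewrite big_nil. Qed.

Lemma der_spanS F n n' x : (n <= n')%N -> der_span F n x -> der_span F n' x.
Proof.
move=> le [l hl ->]; exists l => //; apply: sub_all hl => t h.
exact: leq_trans le.
Qed.

Lemma der_span_iter F n m : (mwt w m < n)%N -> der_span F n (der_iter m F).
Proof.
by move=> h; exists [:: (m, 1)]; rewrite /= ?h // big_seq1 mul1r.
Qed.

Lemma der_span_der F n a x : der_span F n x -> der_span F (n + w a)%N (D a x).
Proof.
move=> [l + ->]; elim: l => [_|t l IHl /= /andP[ht hl]].
  by rewrite big_nil der0; exact: der_span0.
rewrite big_cons DD; apply: der_spanD; last exact: IHl.
rewrite DM -der_iterM; apply: der_spanD; apply: der_spanM; apply: der_span_iter.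
  exact: ltn_addr.
by rewrite mwtM mwtU ltn_add2r.
Qed.

Lemma der_iter_span_mul F x m :
  der_span F (mwt w m).+1 (der_iter m (F * x)).
Proof.
elim/cmonom_ind: m => [|m a IHm].
  rewrite mwt1 der_iter1 mulrC -{2}(der_iter1 F).
  by apply/der_spanM/der_span_iter; rewrite mwt1.
by rewrite der_iterM mwtM mwtU -addSn; exact: der_span_der.
Qed.

Hypothesis w_gt0 : forall a, (0 < w a)%N.

(** In the Leibniz expansion, every term other than [x * der_iter m F] differentiates [F] less; as
    weights are positive, its weight drops strictly. *)
Lemma der_iter_mul_span F x m :
  der_span F (mwt w m) (der_iter m (x * F) - x * der_iter m F).
Proof.
elim/cmonom_ind: m => [|m a IHm].
  by rewrite !der_iter1 subrr; exact: der_span0.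
rewrite !der_iterM mwtM mwtU.
have aux y t : D a y - x * D a t = D a (y - x * t) + D a x * t.
  by rewrite -{1}[y](subrK (x * t)) (DD a (y - x * t)) DM addrA addrK.
rewrite aux.
apply: der_spanD; first exact: der_span_der.
by apply/der_spanM/der_span_iter; rewrite -addn1 leq_add2l.
Qed.

Lemma der_span_morph0 (M : comNzRingType) (theta : {rmorphism R -> M}) F n x :
  (forall m, (mwt w m < n)%N -> theta (der_iter m F) = 0) ->
  der_span F n x -> theta x = 0.
Proof.
move=> h [l + ->]; elim: l => [_|t l IHl /= /andP[ht hl]].
  by rewrite big_nil rmorph0.
by rewrite big_cons rmorphD rmorphM /= h // mulr0 add0r IHl.
Qed.

(** Allows [F] to be replaced by a factor [P] of [s * F]. By induction on the weight:
    [s * der_iter m F] is a derivative of [P * Q] up to lower derivatives of [F], and [theta s] is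
    invertible. *)
Lemma der_iter_morph0_factor (M : comNzRingType) (theta : {rmorphism R -> M})
    (F P Q s : R) (t : M) n : s * F = P * Q -> t * theta s = 1 ->
  (forall m, (mwt w m < n)%N -> theta (der_iter m P) = 0) ->
  forall m, (mwt w m < n)%N -> theta (der_iter m F) = 0.
Proof.
move=> sF ts hP m; elim: {m}(mwt w m).+1 {-2}m (ltnSn (mwt w m)) => // N IHN m.
rewrite ltnS => mN mn; rewrite -[LHS]mul1r -ts -mulrA -rmorphM.
have -> : s * der_iter m F = der_iter m (P * Q) -
    (der_iter m (s * F) - s * der_iter m F) by rewrite sF subKr.
rewrite rmorphB (der_span_morph0 _ (der_iter_span_mul P Q m)) => [|m' hm'].
  rewrite (der_span_morph0 _ (der_iter_mul_span F s m)) => [|m' hm'].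
    by rewrite subr0 mulr0.
  by apply: IHN; [exact: leq_trans mN|exact: ltn_trans mn].
by apply: hP; exact: leq_trans mn.
Qed.

End DifferentialIdeal.

Lemma separable_factor (A : idomainType) (F : {poly A}) :
  [pchar A] =i pred0 -> (1 < size F)%N ->
  exists s d : A, exists P Q u v : {poly A},
    [/\ s != 0, d != 0, (1 < size P)%N, s *: F = P * Q &
        u * P + v * P^`() = d%:P].
Proof.
move=> /pcharf0P A0 sF; have F0 : F != 0 by rewrite -size_poly_gt0 ltnW.
pose g := gcdp F F^`(); pose P := F %/ g.
have F'0 : F^`() != 0.
  apply/eqP => /(congr1 (fun p : {poly A} => p`_(size F).-2)).
  rewrite coef_deriv coef0.
  case: (size F) sF (lead_coefE F) => [//|[//|n]] _ /= <- /eqP.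
  by rewrite -mulr_natr mulf_eq0 lead_coef_eq0 (negPf F0) A0.
have gF : g %| F by exact: dvdp_gcdl.
have g0 : g != 0 by rewrite gcdp_eq0 negb_and F0.
have sg : (size g < size F)%N.
  apply: leq_ltn_trans (lt_size_deriv F0); apply: dvdp_leq => //.
  exact: dvdp_gcdr.
have cop : coprimep P P^`() by have := make_separable F0; rewrite unlock.
have [[u v] /= /eqpP[[c1 c2] /andP[/= c10 c20] uv]] := Bezoutp P P^`().
move: cop; rewrite /coprimep => /size_poly1P[c c0 gc].
exists (lead_coef g ^+ scalp F g), (c2 * c), P, g, (c1 *: u), (c1 *: v); split.
- by rewrite expf_neq0 // lead_coef_eq0.
- by rewrite mulf_neq0.
- rewrite Pdiv.Idomain.size_divp // -subn1 ltn_subRL subn1 addn1 prednK //.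
  by rewrite size_poly_gt0.
- by rewrite Pdiv.Idomain.divpK.
- by rewrite -!scalerAl -scalerDr uv gc polyCM mul_polyC.
Qed.

(** * Elimination of the derivatives of the leader *)

Lemma in_vars_msupp (k : fieldType) (I : choiceType) (S : I -> Prop)
    (p : {malg k[{cmonom I}]}) m i :
  in_vars S p -> m \in msupp p -> (0 < m i)%N -> S i.
Proof.
move=> Sp; elim: Sp m => {p} [c|j Sj|p q _ IHp _ IHq|p q _ IHp _ IHq] m.
- move=> /(fsubsetP (msuppZ_le _ _)).
  rewrite -[1]/(<< mone >> : {malg k[{cmonom I}]}) msuppU1.
  by rewrite in_fset1 => /eqP ->; rewrite cm1.
- by rewrite msuppU1 in_fset1 => /eqP ->; rewrite ucmE; case: eqP => // <-.
- by move=> /(fsubsetP (msuppD_le _ _)); rewrite in_fsetU => /orP[/IHp|/IHq].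
- move=> /msuppM_le[m1 [m2 [m1p m2q ->]]]; rewrite cmM addn_gt0.
  by move=> /orP[/(IHp _ m1p)|/(IHq _ m2q)].
Qed.

Lemma in_vars_eq (k : fieldType) (I : choiceType) (S : I -> Prop)
  (p q : {malg k[{cmonom I}]}) : p = q -> in_vars S q -> in_vars S p.
Proof. by move=> ->. Qed.

Lemma exists_seq_max (T : eqType) (f : T -> nat) (s : seq T) : s <> [::] ->
  exists2 x, x \in s & forall y, y \in s -> (f y <= f x)%N.
Proof.
elim: s => // x s IHs _; case: s IHs => [_|z s IHs].
  by exists x; rewrite ?mem_head // => y; rewrite inE => /eqP ->.
have [//|y ys hy] := IHs; have [le|/ltnW le] := leqP (f x) (f y).
  exists y; first by rewrite inE ys orbT.
  by move=> t; rewrite inE => /predU1P[-> //|/hy].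
exists x; first exact: mem_head.
by move=> t; rewrite inE => /predU1P[-> //|/hy h]; exact: leq_trans le.
Qed.

Lemma in_vars_mp_eval (k : fieldType) (I I' : choiceType) (S : I -> Prop)
    (h : I' -> I) (p : {malg k[{cmonom I'}]}) :
  (forall i, S (h i)) ->
  in_vars S (mp_eval (in_alg {malg k[{cmonom I}]}) (fun i => << ucm (h i) >>) p).
Proof.
move=> Sh; elim/mpoly_ind: p => [c|i|p q IHp IHq|p q IHp IHq].
- by rewrite mp_evalC; exact: in_varsC.
- by rewrite mp_evalX; exact: in_varsX.
- by rewrite mp_evalD; exact: in_varsD.
- by rewrite mp_evalM; exact: in_varsM.
Qed.

Lemma mp_eval_in_vars (k : fieldType) (I : choiceType) (B : comNzRingType)
    (f : {rmorphism k -> B}) (h h' : I -> B) (S : I -> Prop) p :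
  (forall i, S i -> h i = h' i) -> in_vars S p -> mp_eval f h p = mp_eval f h' p.
Proof.
move=> hh'; apply: (in_vars_ext (phi := mp_eval f h) (psi := mp_eval f h')).
  by move=> c; rewrite /= !mp_evalC.
by move=> i Si; rewrite /= !mp_evalX hh'.
Qed.

Lemma in_qpoly_monic (k : fieldType) (h : {poly k}) :
  h \is monic -> (1 < size h)%N -> in_qpoly h h = 0.
Proof.
move=> hm hs; apply: val_inj => /=; rewrite /mk_monic hs hm /=.
by rewrite Pdiv.RingMonic.rmodpp.
Qed.

Section JetElimination.
Variables (k : fieldType) (V : choiceType) (J : finType).
Local Notation I := (V + {cmonom J})%type.
Local Notation P := {malg k[{cmonom I}]}.
Variable D : J -> P -> P.
Hypothesis DD : forall a x y, D a (x + y) = D a x + D a y.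
Hypothesis DM : forall a x y, D a (x * y) = D a x * y + x * D a y.
Hypothesis DC : forall a b x, D a (D b x) = D b (D a x).
Hypothesis Dk : forall a (c : k), D a c%:A = 0.

Definition is_base (i : I) : Prop := if i is inl _ then True else False.

Local Notation jet m := (<< ucm (inr m : I) >> : P).

Hypothesis Dbase : forall a v, in_vars is_base (D a << ucm (inl v : I) >>).
Hypothesis Djet : forall a m, D a (jet m) = jet (mmul m (ucm a)).

Variable w : J -> nat.
Hypothesis w_gt0 : forall a, (0 < w a)%N.

Definition lower (n : nat) (i : I) : bool :=
  if i is inr m then (mwt w m < n)%N else true.

Lemma lowerS n n' i : (n <= n')%N -> lower n i -> lower n' i.
Proof. by case: i => // m le /= h; exact: leq_trans le. Qed.

Lemma in_vars_lowerS n n' (p : P) : (n <= n')%N -> in_vars (lower n) p ->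
  in_vars (lower n') p.
Proof. by move=> le; apply: in_varsS => i; exact: lowerS. Qed.

Lemma base_lower n (p : P) : in_vars is_base p -> in_vars (lower n) p.
Proof. by apply: in_varsS => -[]. Qed.

Lemma der_lower n (p : P) a :
  in_vars (lower n) p -> in_vars (lower (n + w a)) (D a p).
Proof.
have le : (n <= n + w a)%N by exact: leq_addr.
elim=> [c|[v|m] hm|{}p q hp IHp hq IHq|{}p q hp IHp hq IHq].
- by rewrite Dk; exact: in_vars0.
- exact/base_lower.
- by rewrite Djet; apply: in_varsX; rewrite /= mwtM mwtU ltn_add2r.
- by rewrite DD; exact: in_varsD.
- by rewrite DM; apply: in_varsD; apply: in_varsM => //; exact: in_vars_lowerS le _.
Qed.

Lemma der_iter_lower n (p : P) m : in_vars (lower n) p ->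
  in_vars (lower (n + mwt w m)) (der_iter D m p).
Proof.
move=> hp; elim/cmonom_ind: m => [|m a IHm]; first by rewrite mwt1 addn0 der_iter1.
by rewrite (der_iterM DC) mwtM mwtU addnA; exact: der_lower.
Qed.

Variable lam : {cmonom J}.
Local Notation N := (mwt w lam).
Local Notation I' := {i : I | lower N i}.
Local Notation R' := {malg k[{cmonom I'}]}.

Let emb : R' -> P := mp_eval (in_alg P) (fun i => << ucm (val i) >>).

HB.instance Definition _ := GRing.RMorphism.on emb.

Let embD x y : emb (x + y) = emb x + emb y. Proof. exact: rmorphD. Qed.

Let embM x y : emb (x * y) = emb x * emb y. Proof. exact: rmorphM. Qed.

(** Presents differential polynomials as univariate polynomials in the leader [jet lam] over the
    ring [R'] of lower variables, so that the gcd theory of [{poly R'}] applies. *)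
Definition at_leader (q : {poly R'}) : P := (map_poly emb q).[jet lam].

Lemma at_leaderD p q : at_leader (p + q) = at_leader p + at_leader q.
Proof. by rewrite /at_leader rmorphD hornerD. Qed.

Lemma at_leaderM p q : at_leader (p * q) = at_leader p * at_leader q.
Proof. by rewrite /at_leader rmorphM hornerM. Qed.

Lemma at_leaderC c : at_leader c%:P = emb c.
Proof. by rewrite /at_leader map_polyC hornerC. Qed.

Lemma at_leaderX : at_leader 'X = jet lam.
Proof. by rewrite /at_leader map_polyX hornerX. Qed.

Lemma emb_lower c : in_vars (lower N) (emb c).
Proof. by apply: in_vars_mp_eval => i; exact: valP. Qed.

Lemma at_leader_lower q : in_vars (lower N.+1) (at_leader q).
Proof.
elim/poly_ind: q => [|q c IHq].
  by rewrite /at_leader rmorph0 horner0; exact: in_vars0.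
rewrite at_leaderD at_leaderM at_leaderC at_leaderX.
apply: in_varsD; last exact: in_vars_lowerS (emb_lower c).
by apply: in_varsM => //; apply: in_varsX; exact: ltnSn.
Qed.

Lemma der_at_leader q a : in_vars (lower (N + w a))
  (D a (at_leader q) - at_leader q^`() * jet (mmul lam (ucm a))).
Proof.
have D0 : D a 0 = 0 by exact: der0.
elim/poly_ind: q => [|q c IHq].
  rewrite deriv0 -[0 in X in D a X]polyC0 !at_leaderC rmorph0 D0 mul0r subrr.
  exact: in_vars0.
rewrite derivD derivM derivX derivC addr0 mulr1 !at_leaderD !at_leaderM at_leaderC.
rewrite at_leaderX DD DM Djet.
have rE (A : comNzRingType) (u v x y z t : A) :
    u * x + t * y + z - (v * x + t) * y = (u - v * y) * x + z by ring.
apply: (in_vars_eq (rE P _ _ _ _ _ _)).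
apply: in_varsD; last by apply/der_lower/emb_lower.
apply: in_varsM => //; apply: in_varsX => /=.
by rewrite -[X in (X < _)%N]addn0 ltn_add2l.
Qed.

Lemma der_iter_at_leader q m : m != mone -> in_vars (lower (N + mwt w m))
  (der_iter D m (at_leader q) - at_leader q^`() * jet (mmul lam m)).
Proof.
elim/cmonom_ind: m => [|m a IHm _]; first by rewrite eqxx.
have [->|m1] := eqVneq m mone.
  have -> : der_iter D (mmul mone (ucm a)) (at_leader q) = D a (at_leader q).
    by rewrite (der_iterM DC) der_iter1.
  by rewrite mul1m mwtU; exact: der_at_leader.
rewrite (der_iterM DC) mwtM mwtU addnA.
have := IHm m1; move: (der_iter _ _ _) => u IHu.
have uE := esym (subrK (at_leader q^`() * jet (mmul lam m)) u).
rewrite uE [D a _]DD DM Djet.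
have rE (A : comNzRingType) (x y z t u0 : A) :
    u0 + (x * y + z * t) - z * t = u0 + x * y.
  by ring.
rewrite mulmA; apply: (in_vars_eq (rE P _ _ _ _ _)).
apply: in_varsD; first exact/der_lower.
apply: in_varsM.
  apply: (@in_vars_lowerS (N.+1 + w a)); last by apply/der_lower/at_leader_lower.
  by rewrite leq_add2r -addn1 leq_add2l mwt_gt0.
by apply: in_varsX; rewrite /= mwtM -[X in (X < _)%N]addn0 ltn_add2l.
Qed.

Section Prolongation.
Variables (M : comNzRingType) (f : {rmorphism k -> M}).

(* The equation [der_iter D m (at_leader q) = 0] is linear in the jet of order
   [lam * m], with the separant of [q] as leading coefficient, so the values of
   the jets can be chosen successively, by increasing weight. *)
Lemma exists_prolongation (q : {poly R'}) (eta0 : I -> M) (t : M) n :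
  mp_eval f eta0 (at_leader q) = 0 ->
  t * mp_eval f eta0 (at_leader q^`()) = 1 ->
  exists2 eta : I -> M, (forall i, lower N.+1 i -> eta i = eta0 i) &
    forall m, (mwt w m <= n)%N -> mp_eval f eta (der_iter D m (at_leader q)) = 0.
Proof.
move=> q0 ts; elim: n => [|n [eta eta_low eta_der]].
  exists eta0 => // m; rewrite leqNgt => hm; have -> : m = mone.
    by apply/eqP; apply: contraNT hm; exact: mwt_gt0.
  by rewrite der_iter1.
pose S := at_leader q^`().
pose T m := der_iter D m (at_leader q) - S * jet (mmul lam m).
(* Only jets [mmul lam m'] with [m'] of weight [n.+1] are reassigned, each by solving its own linear
   equation with the inverse [t] of the separant. As [divcm] truncates, the first test says that
   [lam] divides [m]. *)
pose eta' (i : I) : M := if i is inr m then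
    let m' := divcm m lam in
    if (mmul lam m' == m) && (mwt w m' == n.+1) then - t * mp_eval f eta (T m')
    else eta i
  else eta i.
have eta'_low i : lower (N + n.+1) i -> eta' i = eta i.
  case: i => //= m; case: eqP => //= mE; case: eqP => // m'E.
  by rewrite -mE mwtM m'E ltnn.
have eta'E p : in_vars (lower (N + n.+1)) p -> mp_eval f eta' p = mp_eval f eta p.
  by apply: mp_eval_in_vars.
exists eta' => [i hi|m].
  rewrite eta'_low ?eta_low //; apply: lowerS hi.
  by rewrite -addn1 leq_add2l.
rewrite leq_eqVlt ltnS => /predU1P[mn|mn]; last first.
  rewrite eta'E ?eta_der //.
  apply: in_vars_lowerS (der_iter_lower _ (at_leader_lower q)).
  by rewrite addSn -addnS leq_add2l ltnS.
have m1 : m != mone by apply: contra_eq_neq mn => ->; rewrite mwt1.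
have pE : der_iter D m (at_leader q) = S * jet (mmul lam m) + T m.
  by rewrite addrC subrK.
have divE : divcm (mmul lam m) lam = m.
  by apply/eqP/cmP => j; rewrite divcmE cmM addKn.
have eta'm : eta' (inr (mmul lam m)) = - t * mp_eval f eta (T m).
  by rewrite /eta' /= divE eqxx mn eqxx.
have Tlow : in_vars (lower (N + n.+1)) (T m).
  by rewrite -mn; exact: der_iter_at_leader.
have Slow : in_vars (lower N.+1) S by exact: at_leader_lower.
have SE : mp_eval f eta' S = mp_eval f eta0 S.
  rewrite eta'E; first exact: mp_eval_in_vars eta_low _.
  by apply: in_vars_lowerS Slow; rewrite -addn1 leq_add2l.
rewrite pE mp_evalD mp_evalM mp_evalX eta'm (eta'E _ Tlow) SE.
by rewrite mulrA mulrN [_ * t]mulrC ts mulN1r addNr.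
Qed.

End Prolongation.

Lemma at_leader_surj (F : P) :
  in_vars (fun i => lower N i || (i == inr lam)) F ->
  exists q, at_leader q = F.
Proof.
elim=> [c|i|{}p q _ [p' <-] _ [q' <-]|{}p q _ [p' <-] _ [q' <-]].
- by exists c%:A%:P; rewrite at_leaderC /emb mp_evalC.
- have [hi _|_ /= /eqP ->] := boolP (lower N i); last first.
    by exists 'X; rewrite at_leaderX.
  by exists << ucm (Sub i hi : I') >>%:P; rewrite at_leaderC /emb mp_evalX.
- by exists (p' + q'); rewrite at_leaderD.
- by exists (p' * q'); rewrite at_leaderM.
Qed.

Lemma emb_surj (F : P) : in_vars (lower N) F -> exists c, emb c = F.
Proof.
elim=> [c|i hi|{}p q _ [p' <-] _ [q' <-]|{}p q _ [p' <-] _ [q' <-]].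
- by exists c%:A; rewrite /emb mp_evalC.
- by exists << ucm (Sub i hi : I') >>; rewrite /emb mp_evalX.
- by exists (p' + q'); rewrite embD.
- by exists (p' * q'); rewrite embM.
Qed.

(** For nonzero [c], a point with values in a nonzero ring is built at which all derivatives of [F]
    of weight below [n] vanish but [c] does not: specialize the lower variables, adjoin a root of
    the separable factor as value of the leader, then prolong. *)
Lemma leader_elimination (F c : P) n : [pchar k] =i pred0 ->
  in_vars (fun i => lower N i || (i == inr lam)) F -> ~ in_vars (lower N) F ->
  in_vars is_base c -> der_span D w F n c -> c = 0.
Proof.
move=> k0 hF Fnlow cbase cF; apply/eqP/negPn/negP => c0.
have [Fq FqE] := at_leader_surj hF.
have [cq cqE] := emb_surj (base_lower N cbase).
have cq0 : cq != 0 by apply: contra c0 => /eqP cq0; rewrite -cqE cq0 rmorph0.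
have sFq : (1 < size Fq)%N.
  rewrite ltnNge; apply/negP => /size1_polyC FqC; apply: Fnlow.
  by rewrite -FqE FqC at_leaderC; exact: emb_lower.
have R'0 : [pchar R'] =i pred0 by move=> p; rewrite pchar_lalg k0.
have [s [d [Pq [Qq [u [v [s0 d0 sPq sFqE uv]]]]]]] := separable_factor R'0 sFq.
have Pq0 : Pq != 0 by rewrite -size_poly_gt0 ltnW.
(* One point keeps four elements nonzero: [s] to pass from [Pq] back to [F], [d] to invert the
   separant, the leading coefficient to preserve the degree of [Pq], and [cq] for the
   contradiction. *)
have [h' h'0] : exists h' : I' -> k,
    mp_eval idfun h' (s * d * lead_coef Pq * cq) != 0.
  by apply: exists_nonzero_eval k0 _; rewrite !mulf_neq0 ?lead_coef_eq0.
pose tau : {rmorphism R' -> k} := mp_eval idfun h'.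
have : [&& tau s != 0, tau d != 0, tau (lead_coef Pq) != 0 & tau cq != 0].
  move: h'0; rewrite -[mp_eval _ _]/(tau : _ -> _).
  by rewrite !rmorphM !mulf_eq0 !negb_or -!andbA.
case/and4P => ts td tP tc.
have sPt : size (map_poly tau Pq) = size Pq by exact: size_map_poly_id0.
pose lc := lead_coef (map_poly tau Pq).
have lc0 : lc != 0 by rewrite lead_coef_eq0 -size_poly_gt0 sPt ltnW.
pose h := lc^-1 *: map_poly tau Pq.
have hm : h \is monic by rewrite monicE lead_coefZ mulVf.
have hs : (1 < size h)%N by rewrite size_scale ?invr_eq0 // sPt.
(* The polynomial [h] need not be irreducible, so [M] may have zero divisors; a nonzero ring with
   invertible separant suffices. *)
pose M := {poly %/ h}.
pose f : {rmorphism k -> M} := in_qpoly h \o polyC.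
(* The class of ['X] is the required value at the leader and merely a default at the other jets that
   are not lower. *)
pose eta0 (i : I) : M := if insub i is Some i' then f (h' i') else in_qpoly h 'X.
have eta0_emb x : mp_eval f eta0 (emb x) = f (tau x).
  elim/mpoly_ind: x => [a|i|p q IHp IHq|p q IHp IHq].
  - by rewrite /emb mp_evalC mp_evalC /tau /= mp_evalC.
  - rewrite /emb mp_evalX mp_evalX /tau /= mp_evalX /eta0.
    by rewrite insubT; [exact: valP|move=> hi; congr (f (h' _)); exact: val_inj].
  - apply: (etrans (congr1 _ (embD p q))); apply: (etrans (mp_evalD f eta0 _ _)).
    apply: (etrans (congr2 +%R IHp IHq)); apply: esym.
    exact: (etrans (congr1 f (rmorphD tau p q)) (rmorphD f _ _)).
  - apply: (etrans (congr1 _ (embM p q))); apply: (etrans (mp_evalM f eta0 _ _)).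
    apply: (etrans (congr2 *%R IHp IHq)); apply: esym.
    exact: (etrans (congr1 f (rmorphM tau p q)) (rmorphM f _ _)).
have eta0_at q : mp_eval f eta0 (at_leader q) = in_qpoly h (map_poly tau q).
  elim/poly_ind: q => [|q x IHq].
    by rewrite -polyC0 at_leaderC eta0_emb !rmorph0.
  rewrite at_leaderD at_leaderM at_leaderC at_leaderX mp_evalD mp_evalM IHq.
  rewrite eta0_emb mp_evalX !(rmorphD, rmorphM) /= map_polyX map_polyC.
  congr (_ * _ + _); rewrite /eta0 insubF //=; exact: ltnn.
have P0 : in_qpoly h (map_poly tau Pq) = 0.
  have -> : map_poly tau Pq = lc *: h by rewrite scalerA divff ?scale1r.
  by rewrite in_qpolyZ in_qpoly_monic ?scaler0.
(* Modulo [h] the Bezout relation loses its term in [Pq], so [v] divided by [d] inverts the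
   separant. *)
pose t : M := f (tau d)^-1 * in_qpoly h (map_poly tau v).
have tS : t * mp_eval f eta0 (at_leader Pq^`()) = 1.
  have vE : in_qpoly h (map_poly tau v) * in_qpoly h (map_poly tau Pq^`())
      = f (tau d).
    have := congr1 (fun q => in_qpoly h (map_poly tau q)) uv.
    rewrite map_polyC -[RHS]/(f (tau d)) => <-.
    rewrite (rmorphD (map_poly tau)) !(rmorphM (map_poly tau)).
    by rewrite rmorphD !rmorphM /= P0 mulr0 add0r.
  rewrite /t -mulrA (eta0_at Pq^`()) vE.
  by rewrite -(rmorphM f) mulVf ?(rmorph1 f).
have {}P0 := etrans (eta0_at Pq) P0.
have [eta eta_low eta_der] := exists_prolongation n P0 tS.
have etaE x : in_vars (lower N.+1) x -> mp_eval f eta x = mp_eval f eta0 x.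
  by apply: mp_eval_in_vars.
have emb_eta x : mp_eval f eta (emb x) = f (tau x).
  by rewrite etaE ?eta0_emb //; apply: in_vars_lowerS (emb_lower x).
have sFE : emb s * F = at_leader Pq * at_leader Qq.
  by rewrite -FqE -at_leaderM -sFqE -at_leaderC -at_leaderM mul_polyC.
have eta_s : f (tau s)^-1 * mp_eval f eta (emb s) = 1.
  by rewrite emb_eta -rmorphM mulVf ?rmorph1.
have eta_F := der_iter_morph0_factor DD DM DC w_gt0 (theta := mp_eval f eta)
  sFE eta_s (fun m hm => eta_der m (ltnW hm)).
have := der_span_morph0 (theta := mp_eval f eta) eta_F cF.
rewrite /= -cqE emb_eta => ftc; have := oner_neq0 M.
by rewrite -(rmorph1 f) -(mulVf tc) rmorphM ftc mulr0 eqxx.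
Qed.

End JetElimination.

(** What remains is to choose a ranking: finitely many jets occur in [F], a separating weight
    distinguishes them, and the heaviest one is taken as leader. *)
Lemma jet_elimination (k : fieldType) (V : choiceType) (J : finType)
    (D : J -> {malg k[{cmonom (V + {cmonom J})%type}]} ->
              {malg k[{cmonom (V + {cmonom J})%type}]})
    (F c : {malg k[{cmonom (V + {cmonom J})%type}]})
    (l : seq ({cmonom J} * {malg k[{cmonom (V + {cmonom J})%type}]})) :
  (forall a x y, D a (x + y) = D a x + D a y) ->
  (forall a x y, D a (x * y) = D a x * y + x * D a y) ->
  (forall a b x, D a (D b x) = D b (D a x)) ->
  (forall a (x : k), D a x%:A = 0) ->
  (forall a v, in_vars (@is_base V J) (D a << ucm (inl v) >>)) ->
  (forall a m, D a << ucm (inr m) >> = << ucm (inr (mmul m (ucm a))) >>) ->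
  [pchar k] =i pred0 ->
  ~ in_vars (@is_base V J) F -> in_vars (@is_base V J) c ->
  c = \sum_(t <- l) t.2 * der_iter D t.1 F -> c = 0.
Proof.
move=> DD DM DC Dk Dbase Djet k0 Fbase cbase cE.
pose jets (m : {cmonom (V + {cmonom J})%type}) : seq {cmonom J} :=
  pmap (fun i => if i is inr a then Some a else None) (finsupp m).
pose L := flatten [seq jets m | m <- msupp F].
have occL m a : m \in msupp F -> (0 < m (inr a))%N -> a \in L.
  move=> mF ma; apply/flattenP; exists (jets m); first exact: map_f.
  rewrite mem_pmap; apply/mapP; exists (inr a) => //.
  by rewrite -cmE_neq0 -lt0n.
have Locc a : a \in L -> exists2 m, m \in msupp F & (0 < m (inr a))%N.
  case/flattenP => _ /mapP[m mF ->]; rewrite mem_pmap => /mapP[[//|b] bm [->]].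
  by exists m => //; rewrite lt0n cmE_neq0.
have [w w_gt0 w_inj] := exists_separating_weight L.
have L0 : L <> [::].
  move=> L0; apply: Fbase; apply: in_varsS (in_vars_supp F) => -[//|a] [m mF ma].
  by have := occL _ _ mF ma; rewrite L0.
have [lam lamL lam_max] := exists_seq_max (mwt w) L0.
(* Injectivity of the weight on [L] makes every other jet of [F] strictly lower than [lam]; the
   successor in [n] matches the strict bound of [der_span]. *)
apply: (leader_elimination DD DM DC Dk Dbase Djet w_gt0 (lam := lam) (F := F)
  (n := (\max_(t <- l) mwt w t.1).+1) k0) => //.
- apply: in_varsS (in_vars_supp F) => -[//|a] [m mF ma].
  have aL := occL _ _ mF ma; rewrite /= ltn_neqAle lam_max // andbT.
  by apply/orP; case: eqP => [/(w_inj _ _ aL lamL) ->|]; [right|left].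
- have [m mF mlam] := Locc _ lamL.
  by move=> /in_vars_msupp/(_ mF mlam); rewrite /= ltnn.
- exists l => //; apply/allP => t tl; rewrite ltnS.
  exact: (leq_bigmax_seq (P := xpredT) (F := fun t => mwt w t.1) t tl isT).
Qed.

(** * Hamiltonians from words *)

Section LieMonomials.
Variables (k : fieldType) (T : Type).
Local Notation L := (free_lie k T).

Inductive lie_mon : nat -> L -> Prop :=
  | lie_mon_gen x : lie_mon 1 (flie_gen k x)
  | lie_mon_lie m n u v : lie_mon m u -> lie_mon n v -> lie_mon (m + n) (lie u v).

Inductive lie_mon_span : L -> Prop :=
  | lie_mon_span0 : lie_mon_span 0
  | lie_mon_spanD a n u v : lie_mon n u -> lie_mon_span v ->
      lie_mon_span (a *: u + v).

Lemma lie_mon_gt0 n u : lie_mon n u -> (0 < n)%N.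
Proof. by elim=> // m {}n v w _ hm _ hn; rewrite addn_gt0 hm. Qed.

Lemma lie_mon_spanP u : lie_mon_span u.
Proof.
have spanD v w : lie_mon_span v -> lie_mon_span w -> lie_mon_span (v + w).
  move=> sv sw; elim: sv => [|a n x y hx _ IHy]; first by rewrite add0r.
  by rewrite -addrA; exact: lie_mon_spanD hx IHy.
have spanZ a v : lie_mon_span v -> lie_mon_span (a *: v).
  elim=> [|b n x y hx _ IHy]; first by rewrite scaler0; exact: lie_mon_span0.
  by rewrite scalerDr scalerA; exact: lie_mon_spanD hx IHy.
have span_mon n v : lie_mon n v -> lie_mon_span v.
  move=> hv; rewrite -[v]scale1r -[1 *: v]addr0.
  exact: lie_mon_spanD hv lie_mon_span0.
have span_lie v w : lie_mon_span v -> lie_mon_span w -> lie_mon_span (lie v w).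
  move=> sv sw; elim: sv => [|a n x y hx _ IHy].
    by rewrite lie0l; exact: lie_mon_span0.
  rewrite lie_linearl; apply: (spanD _ _ _ IHy); apply: (spanZ).
  elim: sw => [|b m z t hz _ IHt]; first by rewrite lie0r; exact: lie_mon_span0.
  rewrite lie_linearr; apply: (spanD _ _ _ IHt); apply: (spanZ).
  by apply: span_mon; exact: lie_mon_lie hx hz.
elim/flie_class_ind: u => s.
elim: s => [x||s IHs|s IHs t IHt|a s IHs|s IHs t IHt].
- exact: span_mon (lie_mon_gen x).
- exact: lie_mon_span0.
- rewrite -flie_oppE -[flie_opp _]/(- (flie_class s : L)) -scaleN1r.
  exact: spanZ.
- rewrite -flie_addE -[flie_add _ _]/(flie_class s + flie_class t : L).
  exact: spanD.
- rewrite -flie_scaleE -[flie_scale _ _]/(a *: flie_class s : L).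
  exact: spanZ.
- rewrite -flie_brE -[flie_br _ _]/(lie (flie_class s : L) (flie_class t)).
  exact: span_lie.
Qed.

(** The right-normed Dynkin bracketing. A single letter needs its own case, since bracketing it with
    the default value of the empty word would give 0. *)
Fixpoint right_bracket (s : seq T) : L :=
  match s with
  | [::] => 0
  | x :: s' => if s' is [::] then flie_gen k x
               else lie (flie_gen k x) (right_bracket s')
  end.

Lemma right_bracket_cons x s : s <> [::] ->
  right_bracket (x :: s) = lie (flie_gen k x) (right_bracket s).
Proof. by case: s. Qed.

End LieMonomials.

(** * Quadratic Hamiltonians of matrices *)

Section Hamiltonians.
Variables (k : fieldType) (W : finType).
Local Notation P := (symp_poly k W).
Local Notation x_ w := (coord_var k (inl w : W + W)).
Local Notation p_ w := (coord_var k (inr w : W + W)).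
Implicit Types A B : W -> W -> k.

Definition ham A : P := \sum_u \sum_v A u v *: (p_ u * x_ v).

Let partial_px a u v : partial a (p_ u * x_ v) =
  (a == inr u)%:R *: x_ v + (a == inl v)%:R *: p_ u.
Proof.
rewrite partialM (partial_coord k a (inr u)) (partial_coord k a (inl v)).
have natE n (y : P) : n%:R * y = n%:R *: y by rewrite mulr_natl scaler_nat.
by rewrite [X in _ + X]mulrC !natE.
Qed.

Let partial_px_x w u v : partial (inl w) (p_ u * x_ v) = (w == v)%:R *: p_ u.
Proof. by rewrite partial_px scale0r add0r. Qed.

Let partial_px_p w u v : partial (inr w) (p_ u * x_ v) = (w == u)%:R *: x_ v.
Proof. by rewrite partial_px scale0r addr0. Qed.

Lemma partial_ham_x A w : partial (inl w) (ham A) = \sum_u A u w *: p_ u.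
Proof.
rewrite /ham linear_sum; apply: eq_bigr => u _.
rewrite linear_sum (bigD1 w) //= big1 ?addr0 => [|v vw]; rewrite linearZ /=.
  by rewrite partial_px_x eqxx scale1r.
by rewrite partial_px_x eq_sym (negPf vw) scale0r scaler0.
Qed.

Lemma partial_ham_p A w : partial (inr w) (ham A) = \sum_v A w v *: x_ v.
Proof.
rewrite /ham linear_sum (bigD1 w) //= [X in _ + X]big1 ?addr0 => [|u uw].
  rewrite linear_sum; apply: eq_bigr => v _; rewrite linearZ /=.
  by rewrite partial_px_p eqxx scale1r.
rewrite linear_sum big1 // => v _; rewrite linearZ /= partial_px_p.
by rewrite eq_sym (negPf uw) scale0r scaler0.
Qed.

(** The bracket of Hamiltonians is the Hamiltonian of the matrix commutator: the [inl] terms give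
    the product of [A] and [B], the [inr] terms the opposite product. *)
Lemma lie_ham A B : lie (ham A) (ham B) =
  ham (fun u v => \sum_t A u t * B t v - \sum_t B u t * A t v).
Proof.
have prodE A' B' : \sum_t (\sum_u A' u t *: p_ u) * (\sum_v B' t v *: x_ v) =
    ham (fun u v => \sum_t A' u t * B' t v).
  under eq_bigr => t _ do rewrite big_distrlr /=.
  rewrite exchange_big; apply: eq_bigr => u _.
  rewrite exchange_big; apply: eq_bigr => v _.
  rewrite scaler_suml; apply: eq_bigr => t _.
  by rewrite -scalerAl -scalerAr scalerA.
rewrite symp_lieE big_sumType /=.
transitivity (\sum_t (\sum_u A u t *: p_ u) * (\sum_v B t v *: x_ v) +
    \sum_t - ((\sum_u B u t *: p_ u) * (\sum_v A t v *: x_ v))).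
  congr (_ + _); apply: eq_bigr => t _.
    exact: (etrans (scale1r _) (congr2 *%R (partial_ham_x A t) (partial_ham_p B t))).
  apply: (etrans (scaleN1r _)); apply: (congr1 -%R); apply: (etrans (mulrC _ _)).
  exact: (congr2 *%R (partial_ham_x B t) (partial_ham_p A t)).
rewrite sumrN; apply: (etrans (congr2 (fun x y => x - y) (prodE A B) (prodE B A))).
rewrite /ham -sumrB; apply: eq_bigr => u _.
by rewrite -sumrB; apply: eq_bigr => v _; rewrite scalerBl.
Qed.

End Hamiltonians.

Section WordHamiltonians.
Variables (k : fieldType) (T : finType) (c : nat).
Local Notation W := {bseq c of T}.
Local Notation L := (free_lie k T).
Local Notation P := (symp_poly k W).

(** The matrix of left multiplication by the letter [i]; a word of full length [c] is sent to 0,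
    because its product with [i] is too long for [W]. *)
Definition gen_ham (i : T) : P :=
  ham (fun u v : W => ((u : seq T) == i :: (v : seq T))%:R).

Variable psi : L -> P.
Hypothesis psi_lie : {morph psi : x y / lie x y}.
Hypothesis psi_gen : forall i, psi (flie_gen k i) = gen_ham i.

(* Dynkin-Specht-Wever: [psi v] acts on words as left multiplication by [v] in
   the free associative algebra, truncated at length [c], and right bracketing
   turns this action into [ad v] on nonempty words, and into [v |-> n v] on the
   empty word. *)
Lemma lie_mon_ham n v : lie_mon n v -> exists A : W -> W -> k,
  [/\ psi v = ham A,
      forall u w, A u w != 0 -> size u = (size w + n)%N,
      forall w : W, (0 < size w)%N -> (size w + n <= c)%N ->
        \sum_u A u w *: right_bracket k u = lie v (right_bracket k w) &
      forall w : W, size w = 0%N -> (n <= c)%N ->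
        \sum_u A u w *: right_bracket k u = n%:R *: v].
Proof.
elim=> [i|m {}n u {}v hu [A [uE Adeg A1 A0]] hv [B [vE Bdeg B1 B0]]].
  exists (fun u v : W => ((u : seq T) == i :: (v : seq T))%:R).
  have sumE (w : W) : (size w < c)%N ->
      \sum_(u : W) ((u : seq T) == i :: w)%:R *: right_bracket k u =
      right_bracket k (i :: w).
    move=> wc; have iwP : (size (i :: w) <= c)%N by [].
    rewrite (bigD1 (Bseq iwP)) //= eqxx scale1r big1 ?addr0 // => u ne.
    by case: eqP => [uE|]; rewrite ?scale0r //; case/eqP: ne; apply: val_inj.
  split=> // [u w|w w0 wc|w w0 c0].
  - by case: (_ == i :: _) / eqP => [->|_]; rewrite ?addn1 // eqxx.
  - rewrite sumE; last by rewrite addn1 in wc.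
    by rewrite right_bracket_cons // => wE; rewrite wE in w0.
  - by rewrite sumE ?w0 // (size0nil w0) /= scale1r.
pose C u w := \sum_t A u t * B t w - \sum_t B u t * A t w.
have mulE (A' B' : W -> W -> k) w :
    \sum_u (\sum_t A' u t * B' t w) *: right_bracket k u
    = \sum_t B' t w *: (\sum_u A' u t *: right_bracket k u).
  under eq_bigr => x _ do rewrite scaler_suml.
  rewrite exchange_big; apply: eq_bigr => t _; rewrite scaler_sumr.
  by apply: eq_bigr => x _; rewrite scalerA mulrC.
have sumE w : \sum_u C u w *: right_bracket k u =
    \sum_t B t w *: (\sum_u A u t *: right_bracket k u)
    - \sum_t A t w *: (\sum_u B u t *: right_bracket k u).
  by rewrite -!mulE -sumrB; apply: eq_bigr => x _; rewrite scalerBl.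
(* The factor acting first already yields nonempty words, on which the other one acts as [lie x]
   after bracketing. *)
have actE (A' B' : W -> W -> k) (x : L) n1 n2 (w : W) :
    (forall u w : W, B' u w != 0 -> size u = (size w + n2)%N) ->
    (forall w : W, (0 < size w)%N -> (size w + n1 <= c)%N ->
        \sum_u A' u w *: right_bracket k u = lie x (right_bracket k w)) ->
    (0 < size w + n2)%N -> (size w + n2 + n1 <= c)%N ->
    \sum_t B' t w *: (\sum_u A' u t *: right_bracket k u) =
    lie x (\sum_t B' t w *: right_bracket k t).
  move=> B'deg A'1 pos le; pose lx := lie x.
  have lin : linear lx by move=> a y z; rewrite /lx lie_linearr.
  have lsum (F : W -> L) : lx (\sum_t F t) = \sum_t lx (F t).
    by elim/big_rec2: _ => [|t y z _ <-]; rewrite /lx ?lie0r // lieDr.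
  rewrite -/(lx _) lsum; apply: eq_bigr => t _; rewrite /lx lieZr.
  have [->|/B'deg st] := eqVneq (B' t w) 0; first by rewrite !scale0r.
  by rewrite A'1 // st.
exists C; split.
- exact: etrans (psi_lie u v) (etrans (congr2 lie uE vE) (lie_ham A B)).
- move=> x w; apply: contra_neq_eq => sx; rewrite /C !big1 ?subrr // => t _.
    apply/eqP; rewrite mulf_eq0; apply/negPn/negP; rewrite negb_or.
    by move=> /andP[/Bdeg xt /Adeg tw]; case/eqP: sx; rewrite xt tw addnA.
  apply/eqP; rewrite mulf_eq0; apply/negPn/negP; rewrite negb_or.
  move=> /andP[/Adeg xt /Bdeg tw]; case/eqP: sx.
  by rewrite xt tw -addnA [(n + m)%N]addnC.
(* On nonempty words the commutator of the two adjoint actions is the adjoint action of [lie u v],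
   by Jacobi. *)
- move=> w w0; rewrite addnA => wc.
  have wcm : (size w + m <= c)%N by apply: leq_trans wc; exact: leq_addr.
  have wcn : (size w + n <= c)%N by apply: leq_trans wc; rewrite addnAC leq_addr.
  rewrite sumE (actE A B u m n) // ?(actE B A v n m) // ?addn_gt0 ?w0 //;
    last by rewrite addnAC.
  rewrite B1 // A1 //; move: (right_bracket k w) => r.
  have := lie_jacobi u v r; rewrite [lie v (lie r u)]lieC [lie r u]lieC lieNl.
  have -> : lie r (lie u v) = - lie (lie u v) r by rewrite lieC.
  rewrite opprK [lie (lie u r) v]lieC => /eqP.
  by rewrite subr_eq0 => /eqP.
(* On the empty word the two orders give [n] times [lie u v] and [m] times [lie v u], whose
   difference is [(m + n)] times [lie u v]. *)
- move=> w w0 mnc; have m0 := lie_mon_gt0 hu; have n0 := lie_mon_gt0 hv.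
  have mc : (m <= c)%N by apply: leq_trans mnc; exact: leq_addr.
  have nc : (n <= c)%N by apply: leq_trans mnc; exact: leq_addl.
  have nmc : (n + m <= c)%N by rewrite addnC.
  rewrite sumE (actE A B u m n) ?w0 ?add0n // (actE B A v n m) ?w0 ?add0n //.
  rewrite B0 // A0 // !lieZr [lie v u]lieC scalerN opprK -scalerDl.
  by rewrite -natrD addnC.
Qed.

Hypothesis k0 : [pchar k] =i pred0.
Variables (B : comAlgType k) (iota : {linear L -> B}).

(** The values of the x coordinates select the column of the empty word; those of the p coordinates
    bracket the words in it, with the factor [(size u)%:R^-1] undoing the degree in the
    Dynkin-Specht-Wever identity. *)
Definition word_retract : P -> B := mp_eval (in_alg B) (fun v : symp_var W =>
  match v with
  | inl (inl w) => (size w == 0%N)%:R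
  | inl (inr u) => (size u)%:R^-1 *: iota (right_bracket k u)
  | inr _ => 0
  end).

Lemma word_retractD p q : word_retract (p + q) = word_retract p + word_retract q.
Proof. exact: mp_evalD. Qed.

Lemma word_retractM p q : word_retract (p * q) = word_retract p * word_retract q.
Proof. exact: mp_evalM. Qed.

Lemma word_retractZ a p : word_retract (a *: p) = a *: word_retract p.
Proof. by rewrite /word_retract mp_evalZ mulr_algl. Qed.

Lemma word_retract0 : word_retract 0 = 0.
Proof. exact: rmorph0. Qed.

Lemma word_retract_sum (F : W -> P) :
  word_retract (\sum_w F w) = \sum_w word_retract (F w).
Proof.
by elim/big_rec2: _ => [|w x y _ <-]; [exact: word_retract0|exact: word_retractD].
Qed.

Lemma word_retract_ham A (w0 : W) : size w0 = 0%N ->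
  word_retract (ham A) =
  \sum_u A u w0 *: ((size u)%:R^-1 *: iota (right_bracket k u)).
Proof.
move=> s0; rewrite /ham word_retract_sum; apply: eq_bigr => u _.
have termE v : word_retract (A u v *: (coord_var k (inr u) * coord_var k (inl v))) =
    A u v *: (((size u)%:R^-1 *: iota (right_bracket k u)) * (size v == 0%N)%:R).
  rewrite word_retractZ word_retractM; congr (_ *: (_ * _)).
    by rewrite coord_varE /word_retract mp_evalX.
  by rewrite coord_varE /word_retract mp_evalX.
apply: (etrans (word_retract_sum _)).
apply: (etrans (eq_bigr _ (fun v _ => termE v))).
rewrite (bigD1 w0) //= s0 mulr1 [X in _ + X]big1 ?addr0 // => v vw0.
case: (size v =P 0%N) => [sv|_]; last by rewrite mulr0 scaler0.
by case/eqP: vw0; apply: val_inj; rewrite /= (size0nil sv) (size0nil s0).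
Qed.

(** The column of the empty word is supported on words of length [n], so the inverse lengths form a
    common factor that cancels [n%:R], which is invertible in characteristic 0. *)
Lemma word_retract_lie_mon n v : lie_mon n v -> (n <= c)%N ->
  word_retract (psi v) = iota v.
Proof.
move=> hv nc; have [A [-> Adeg _ A0]] := lie_mon_ham hv.
have n0 : n%:R != 0 :> k.
  by move/pcharf0P: k0 => ->; rewrite -lt0n; exact: lie_mon_gt0 hv.
pose w0 : W := Bseq (leq0n c : (size ([::] : seq T) <= c)%N).
rewrite (@word_retract_ham _ w0) //.
transitivity (n%:R^-1 *: iota (\sum_u A u w0 *: right_bracket k u)).
  rewrite linear_sum scaler_sumr; apply: eq_bigr => u _.
  have [->|/Adeg ->] := eqVneq (A u w0) 0.
    by rewrite !scale0r linear0 scaler0.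
  rewrite add0n scalerA mulrC -scalerA; congr (_ *: _).
  by apply: esym; exact: linearZ.
by rewrite A0 // linearZ /= scalerA mulVf // scale1r.
Qed.

End WordHamiltonians.

(** Only finitely many Lie monomials enter [f]; once [c] bounds their degrees, [word_retract]
    recovers [f] from its image. A threshold, rather than a single [c], lets several elements share
    one truncation. *)
Lemma word_ham_faithful (k : fieldType) (T : finType) (f : free_poisson k T) :
  [pchar k] =i pred0 ->
  exists c0, forall c, (c0 <= c)%N ->
  forall Phi : free_poisson k T -> symp_poly k {bseq c of T},
  poisson_hom Phi -> (forall i, Phi (fp_gen k i) = gen_ham k c i) ->
  Phi f = 0 -> f = 0.
Proof.
move=> k0; pose e := hamel_basis (free_lie k T); pose FP := free_poisson k T.
pose iota : {linear free_lie k T -> FP} := ps_inj e.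
pose ret c := @word_retract k T c FP iota.
suff [c0 hc0] : exists c0, forall c, (c0 <= c)%N ->
    forall Phi : FP -> symp_poly k {bseq c of T}, poisson_hom Phi ->
    (forall i, Phi (fp_gen k i) = gen_ham k c i) -> ret c (Phi f) = f.
  exists c0 => c c0c Phi hPhi Phi_gen Phif; rewrite -(hc0 c c0c Phi) // Phif.
  exact: word_retract0.
have inj_case v : exists c0, forall c, (c0 <= c)%N ->
    forall Phi : FP -> symp_poly k {bseq c of T}, poisson_hom Phi ->
    (forall i, Phi (fp_gen k i) = gen_ham k c i) ->
    ret c (Phi (iota v)) = iota v.
  elim: (lie_mon_spanP v) => [|a n x y hx _ [c0 IHy]].
    exists 0%N => c _ Phi hPhi _; rewrite linear0 (phom0 hPhi).
    exact: word_retract0.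
  exists (maxn n c0) => c; rewrite geq_max => /andP[nc c0c] Phi hPhi Phi_gen.
  have iE : iota (a *: x + y) = a *: iota x + iota y by exact: linearP.
  have Hx : ret c (Phi (iota x)) = iota x.
    apply: (@word_retract_lie_mon k T c (Phi \o iota)) hx nc => // u t /=.
    by rewrite -(phom_lie hPhi); congr Phi; exact: ps_inj_lie.
  have Hy := IHy c c0c Phi hPhi Phi_gen.
  rewrite iE (phomD hPhi) (phomZ hPhi) /ret word_retractD word_retractZ.
  exact: (congr2 (fun x y : FP => a *: x + y) Hx Hy).
elim/ps_ind: f => [a|i|p q [c1 IHp] [c2 IHq]|p q [c1 IHp] [c2 IHq]].
- exists 0%N => c _ Phi hPhi _; rewrite (phomZ hPhi) (phom1 hPhi) /ret word_retractZ.
  have ret1 : word_retract iota (1 : symp_poly k {bseq c of T}) = 1.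
    exact: rmorph1.
  exact: (congr1 ( *:%R a) ret1).
- by have := inj_case (e i); rewrite /iota /= ps_inj_basis.
- exists (maxn c1 c2) => c; rewrite geq_max => /andP[c1c c2c] Phi hPhi Phi_gen.
  rewrite (phomD hPhi) /ret word_retractD.
  exact: (congr2 +%R (IHp c c1c Phi hPhi Phi_gen) (IHq c c2c Phi hPhi Phi_gen)).
- exists (maxn c1 c2) => c; rewrite geq_max => /andP[c1c c2c] Phi hPhi Phi_gen.
  rewrite (phomM hPhi) /ret word_retractM.
  exact: (congr2 *%R (IHp c c1c Phi hPhi Phi_gen) (IHq c c2c Phi hPhi Phi_gen)).
Qed.

(** * The Freiheitssatz *)

Section JetEvaluation.
Variables (k : fieldType) (W : finType).
Local Notation J := (W + W)%type.
Local Notation P := (symp_poly k W).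
Implicit Types p q b : P.

Let partialD (a : J) p q : partial a (p + q) = partial a p + partial a q.
Proof. exact: linearD. Qed.

Lemma partial_base (a : J) p : in_vars (@is_base J J) p ->
  in_vars (@is_base J J) (partial a p).
Proof.
elim=> [c|[b|//] _|{}p q hp IHp hq IHq|{}p q hp IHp hq IHq].
- by have -> := partialC a c; exact: in_vars0.
- have := partial_coord k a b; rewrite coord_varE => ->.
  by apply: in_varsMn; exact: in_vars1.
- by have -> := partialD a p q; exact: in_varsD.
- by have -> := partialM a p q; apply: in_varsD; apply: in_varsM.
Qed.

Lemma base_subalgebra : poisson_subalgebra (in_vars (@is_base J J) : set P).
Proof.
split.
- exact: in_vars1.
- by move=> p q; exact: in_varsD.
- by move=> a p; exact: in_varsZ.
- by move=> p q; exact: in_varsM.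
- move=> p q hp hq; rewrite symp_lieE; apply: in_vars_sum => a _.
  by apply: in_varsZ; apply: in_varsM; exact: partial_base.
Qed.

Lemma ham_base (A : W -> W -> k) : in_vars (@is_base J J) (ham A).
Proof.
apply: in_vars_sum => u _; apply: in_vars_sum => v _; apply/in_varsZ/in_varsM.
  by rewrite coord_varE; exact: in_varsX.
by rewrite coord_varE; exact: in_varsX.
Qed.

(* Substitution of [b] for the indeterminate function Y. *)
Definition jet_eval b : P -> P := mp_eval (in_alg P) (fun v : symp_var W =>
  match v with inl a => coord_var k a | inr m => der_iter (@partial k W) m b end).

Lemma jet_evalD b p q : jet_eval b (p + q) = jet_eval b p + jet_eval b q.
Proof. exact: mp_evalD. Qed.

Lemma jet_evalM b p q : jet_eval b (p * q) = jet_eval b p * jet_eval b q.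
Proof. exact: mp_evalM. Qed.

Lemma jet_evalZ b (a : k) p : jet_eval b (a *: p) = a *: jet_eval b p.
Proof. by rewrite /jet_eval mp_evalZ mulr_algl. Qed.

Lemma jet_evalC b (a : k) : jet_eval b a%:A = a%:A.
Proof. exact: mp_evalC. Qed.

Lemma jet_eval_coord b a : jet_eval b (coord_var k a) = coord_var k a.
Proof. by rewrite [in LHS]coord_varE /jet_eval mp_evalX. Qed.

Lemma jet_eval_jet b m : jet_eval b (jet_var k m) = der_iter (@partial k W) m b.
Proof. by rewrite jet_varE /jet_eval mp_evalX. Qed.

Lemma jet_eval_base b p : in_vars (@is_base J J) p -> jet_eval b p = p.
Proof.
elim=> [a|[a|//] _|{}p q _ IHp _ IHq|{}p q _ IHp _ IHq].
- exact: jet_evalC.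
- by have := jet_eval_coord b a; rewrite coord_varE.
- exact: (etrans (jet_evalD b p q) (congr2 +%R IHp IHq)).
- exact: (etrans (jet_evalM b p q) (congr2 *%R IHp IHq)).
Qed.

Lemma partial_jet_eval b a p : partial a (jet_eval b p) = jet_eval b (partial a p).
Proof.
elim/symp_ind: p => [c|a'|m|p q IHp IHq|p q IHp IHq].
- rewrite jet_evalC !partialC; apply: esym.
  by rewrite -(scale0r (1 : P)) jet_evalC.
- rewrite jet_eval_coord !partial_coord; apply: esym.
  by rewrite -scaler_nat; exact: jet_evalC.
- rewrite partial_jet jet_eval_jet; apply: esym.
  by rewrite jet_eval_jet; apply: der_iterM; exact: partial_comm.
- apply: (etrans (congr1 (partial a) (jet_evalD b p q))).
  apply: (etrans (partialD a _ _)); apply: (etrans (congr2 +%R IHp IHq)).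
  exact: esym (etrans (congr1 (jet_eval b) (partialD a p q)) (jet_evalD b _ _)).
- apply: (etrans (congr1 (partial a) (jet_evalM b p q))).
  apply: (etrans (partialM a _ _)).
  apply: (etrans (congr2 (fun x y => x * jet_eval b q + jet_eval b p * y) IHp IHq)).
  apply: esym; apply: (etrans (congr1 (jet_eval b) (partialM a p q))).
  apply: (etrans (jet_evalD b _ _)).
  exact: (congr2 +%R (jet_evalM b _ _) (jet_evalM b _ _)).
Qed.

(** The bracket is built from the derivations [partial a], with which the substitution commutes
    because it sends the jets of Y to the derivatives of [b]. *)
Lemma jet_eval_hom b : poisson_hom (jet_eval b).
Proof.
split=> [a p q||p q].
- by rewrite jet_evalD jet_evalZ.
- split; last by move=> p q; exact: jet_evalM.
  by have := jet_evalC b 1; rewrite scale1r.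
have jet_eval_sum (F : J -> P) : jet_eval b (\sum_a F a) = \sum_a jet_eval b (F a).
  elim/big_rec2: _ => [|a x y _ <-]; last exact: jet_evalD.
  by rewrite -(scale0r (1 : P)) jet_evalC.
rewrite !symp_lieE; apply: (etrans (jet_eval_sum _)); apply: eq_bigr => a _.
rewrite jet_evalZ jet_evalM; apply: (congr1 ( *:%R _)).
exact: (congr2 *%R (esym (partial_jet_eval b a p)) (esym (partial_jet_eval b _ q))).
Qed.

(** The full differential ideal. The constant weight counts the order of a derivative; the union
    over [n] is the same for any weight. *)
Definition der_ideal (F : P) : set P :=
  [set x | exists n, der_span (@partial k W) (fun=> 1%N) F n x].

(** A bracket with [x] is a combination of first derivatives of [x], so stability under derivations
    and products suffices. *)
Lemma der_ideal_poisson F : poisson_ideal (der_ideal F).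
Proof.
have idD x y : der_ideal F x -> der_ideal F y -> der_ideal F (x + y).
  move=> [n hx] [m hy]; exists (maxn n m); apply: der_spanD.
    exact: der_spanS (leq_maxl _ _) hx.
  exact: der_spanS (leq_maxr _ _) hy.
have idM b x : der_ideal F x -> der_ideal F (b * x).
  by move=> [n hx]; exists n; exact: der_spanM.
have id0 : der_ideal F 0 by exists 0%N; exact: der_span0.
have idZ (a : k) x : der_ideal F x -> der_ideal F (a *: x).
  by rewrite -mulr_algl; exact: idM.
split=> // b x [n hx]; rewrite symp_lieE.
elim/big_rec: _ => // a y _; apply: idD; apply/idZ/idM.
exists (n + 1)%N; apply: (der_span_der _ _ _ _ hx).
- exact: partialD.
- exact: partialM.
- exact: partial_comm.
Qed.

Lemma der_ideal_gen F : der_ideal F F.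
Proof.
exists 1%N.
have := der_span_iter (@partial k W) (w := fun=> 1%N) F (n := 1) (m := mone).
by rewrite mwt1 der_iter1; apply.
Qed.

Lemma der_ideal_base F c : [pchar k] =i pred0 ->
  ~ in_vars (@is_base J J) F -> in_vars (@is_base J J) c -> der_ideal F c -> c = 0.
Proof.
move=> k0 Fbase cbase [n [l _ cE]].
apply: (jet_elimination (D := @partial k W) (F := F) (l := l)) => //.
- exact: partialM.
- exact: partial_comm.
- exact: partialC.
- move=> a v; have := partial_coord k a v; rewrite coord_varE => ->.
  by apply: in_varsMn; exact: in_vars1.
- by move=> a m; have := partial_jet k a m; rewrite !jet_varE.
Qed.

End JetEvaluation.

Section Freiheitssatz.
Variables (k : fieldType) (n : nat).
Local Notation FP := (free_poisson k 'I_n).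
Local Notation FP1 := (free_poisson k 'I_n.+1).
Local Notation widen := (widen_ord (leqnSn n)).

Lemma freiheitssatz (f : FP1) (incl : FP -> FP1) (g : FP) :
  [pchar k] =i pred0 -> poisson_hom incl ->
  (forall i, incl (fp_gen k i) = fp_gen k (widen i)) ->
  ~ range incl f -> gen_ideal f (incl g) -> g = 0.
Proof.
move=> k0 hincl incl_gen f_notin fg.
have insub_widen i : insub (val (widen i)) = Some i by exact: valK.
have insub_max : insub (val (ord_max : 'I_n.+1)) = None :> option 'I_n.
  by apply: insubF; rewrite /= ltnn.
have ordP (i : 'I_n.+1) : i = ord_max \/ exists j, i = widen j.
  have [ilt|] := boolP (val i < n)%N; last first.
    rewrite -leqNgt => le; left; apply: val_inj; apply/eqP.
    by rewrite eqn_leq le -ltnS ltn_ord.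
  by right; exists (Ordinal ilt); exact: val_inj.
(* The retraction of [incl] that sends the last generator to 0. *)
have [retr hretr retr_gen] := fp_lift_exists
  (fun i : 'I_n.+1 => oapp (@fp_gen k 'I_n) 0 (insub (val i))).
have inclK : cancel incl retr.
  apply: (fp_hom_ext (phom_comp hretr hincl) (psi := id)) => [|i] /=.
    by split=> //; split.
  by rewrite incl_gen retr_gen insub_widen.
(* Two elements must survive truncation: this difference, nonzero as [f] is outside the range of
   [incl], ensures that [phi f] involves Y; [incl g] must not be killed. *)
have [c1 hc1] := word_ham_faithful (f - incl (retr f)) k0.
have [c2 hc2] := word_ham_faithful (incl g) k0.
pose c := maxn c1 c2; pose W : finType := {bseq c of 'I_n.+1}.
have [phiK hphiK phiK_gen] :=
  fp_lift_exists (gen_ham k c : 'I_n.+1 -> symp_poly k W).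
have [phi hphi phi_gen] := fp_lift_exists
  (fun i : 'I_n.+1 => if (insub (val i) : option 'I_n) is Some _ then gen_ham k c i
                      else jet_var k (mone : {cmonom (W + W)%type})).
have phiK_base x : in_vars (@is_base (W + W)%type (W + W)%type) (phiK x).
  apply: (fp_generated (phom_preimage hphiK (base_subalgebra k W))) => i /=.
  by rewrite phiK_gen; exact: ham_base.
have phi_incl x : phi (incl x) = phiK (incl x).
  apply: (fp_hom_ext (phom_comp hphi hincl) (phom_comp hphiK hincl)) => i /=.
  by rewrite incl_gen phi_gen phiK_gen insub_widen.
have ev_ham x : jet_eval (gen_ham k c ord_max : symp_poly k W) (phi x) = phiK x.
  apply: (fp_hom_ext (phom_comp (jet_eval_hom _) hphi) hphiK) => i /=.
  rewrite phi_gen phiK_gen; have [->|[j ->]] := ordP i.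
    by rewrite insub_max jet_eval_jet der_iter1.
  by rewrite insub_widen jet_eval_base //; exact: ham_base.
have ev_0 x : jet_eval (0 : symp_poly k W) (phi x) = phiK (incl (retr x)).
  apply: (fp_hom_ext (phom_comp (jet_eval_hom _) hphi)
    (phom_comp hphiK (phom_comp hincl hretr))) => i /=.
  rewrite phi_gen retr_gen; have [->|[j ->]] := ordP i.
    by rewrite insub_max jet_eval_jet der_iter1 /= (phom0 hincl) (phom0 hphiK).
  rewrite insub_widen /= incl_gen phiK_gen jet_eval_base //; exact: ham_base.
(* If [phi f] did not involve Y, substituting the last Hamiltonian or 0 for Y would give the same
   result; by faithfulness [f] would equal [incl (retr f)]. *)
have f_nonbase : ~ in_vars (@is_base (W + W)%type (W + W)%type) (phi f).
  move=> f_base; apply: f_notin; exists (retr f) => //.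
  apply/esym/eqP; rewrite -subr_eq0; apply/eqP.
  apply: (hc1 c (leq_maxl _ _) phiK hphiK phiK_gen).
  by rewrite (phomB hphiK) -ev_ham -ev_0 !jet_eval_base // subrr.
(* The image of [incl g] is free of Y and lies in the differential ideal of [phi f], so elimination
   applies. *)
have phi_g0 : phiK (incl g) = 0.
  apply: (der_ideal_base k0 f_nonbase); first exact: phiK_base.
  rewrite -phi_incl; apply: (fg (phi @^-1` der_ideal (phi f))).
    exact: (phom_ideal hphi (der_ideal_poisson _)).
  exact: der_ideal_gen.
rewrite -(inclK g) (hc2 c (leq_maxr _ _) phiK hphiK phiK_gen phi_g0).
exact: phom0 hretr.
Qed.

End Freiheitssatz.

Lemma pquot_class_hom (k : fieldType) (B : poissonAlgType k) (J : set B)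
    (hJ : poisson_ideal J) (J1 : ~ J 1) : poisson_hom (pquot_class hJ J1).
Proof.
split=> [a x y||x y].
- by rewrite pquot_classD pquot_classZ.
- by split=> // x y; exact: pquot_classM.
- by rewrite /lie /= pquot_lieE.
Qed.

(* The number of variables is m = n + 1 >= 1.  That (f) is proper, which is
   implied by the freeness claim, is needed to form the quotient as a
   (nonzero) algebra. *)
Theorem corollary3 (k : fieldType) (n : nat) (f : free_poisson k 'I_n.+1) :
  [pchar k] =i pred0 ->
  ~ gen_subalgebra
      (range (fun i : 'I_n => fp_gen k (widen_ord (leqnSn n) i))) f ->
  exists f_proper : ~ gen_ideal f 1,
    let zbar (i : 'I_n) : poisson_quotient (gen_idealP f) f_proper :=
      pquot_class (gen_idealP f) f_proper (fp_gen k (widen_ord (leqnSn n) i)) in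
    free_poisson_on (gen_subalgebra (range zbar)) zbar.
Proof.
move=> k0 f_notin.
have [incl hincl incl_gen] := fp_lift_exists
  (fun i : 'I_n => fp_gen k (widen_ord (leqnSn n) i)).
have inclE : (fun i => incl (fp_gen k i)) =
    fun i : 'I_n => fp_gen k (widen_ord (leqnSn n) i) by exact: funext.
have f_range : ~ range incl f by rewrite (fp_hom_range hincl) inclE.
have freeE g : gen_ideal f (incl g) -> g = 0.
  exact: freiheitssatz k0 hincl incl_gen f_range.
(* As [1] is the image of [1] under [incl], its membership in the ideal would force [1 = 0] in the
   smaller free algebra. *)
have f_proper : ~ gen_ideal f 1.
  by rewrite -(phom1 hincl) => /freeE /eqP; rewrite oner_eq0.
exists f_proper; rewrite /free_poisson_on.
have hcl := pquot_class_hom (gen_idealP f) f_proper.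
have hphi := phom_comp hcl hincl.
exists (pquot_class (gen_idealP f) f_proper \o incl); split=> // [x y|x|].
- move=> /= /pquot_eqP; rewrite -(phomB hincl) => /freeE /eqP.
  by rewrite subr_eq0 => /eqP.
- by rewrite /= incl_gen.
- rewrite (fp_hom_range hphi); apply: (congr1 (fun w => gen_subalgebra (range w))).
  by apply: funext => i; rewrite /= incl_gen.
Qed.
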